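(* Let $K$ and $K'$ be self-similar sets generated by two IFSs of similitudes of the form $x\mapsto rR_ix+d_i$ ($i=1,\dots,m$), with the same number $m$ of similitudes and the same contraction ratio $r\in(0,1)$, and both satisfying condition (H). Assume that the associated augmented trees (each with respect to a bounded closed invariant set of its IFS) are simple and that each of the incidence matrices is $(m,\mathbf b)$-rearrangeable, where $\mathbf b$ is the vector of cardinalities of the connected classes of the respective tree (in particular, the conclusion holds if the incidence matrices are primitive). Then $K$ and $K'$ are Lipschitz equivalent, and are also Lipschitz equivalent to a dust-like self-similar set.
   Context: IFS: $S_i(x)=rR_ix+d_i$, $i=1,\dots,m$, with $0<r<1$, $R_i$ orthogonal, $d_i\in\mathbb R^d$; the self-similar set $K$ is the nonempty compact set with $K=\bigcup_iS_i(K)$. It is dust-like if $S_i(K)\cap S_j(K)=\emptyset$ for $i\ne j$. (The dust-like set is the attractor of such an IFS on some Euclidean space.) $\Sigma=\{1,\dots,m\}$, $X=\bigcup_{n\ge0}\Sigma^n$, $\Sigma^0=\{o\}$ (empty word); $S_{\mathbf u}=S_{i_1}\circ\cdots\circ S_{i_n}$, $K_{\mathbf u}=S_{\mathbf u}(K)$ for $\mathbf u=i_1\cdots i_n$. Condition (H): there is $c>0$ such that for all $n\ge1$ and $\mathbf u,\mathbf v\in\Sigma^n$, $K_{\mathbf u}\cap K_{\mathbf v}=\emptyset$ implies $\mathrm{dist}(K_{\mathbf u},K_{\mathbf v})\ge cr^n$. Augmented tree $(X,\mathcal E)$: $J$ is a fixed nonempty bounded closed set with $S_i(J)\subset J$ for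 all $i$; $J_{\mathbf u}=S_{\mathbf u}(J)$. $\mathcal E=\mathcal E_v\cup\mathcal E_h$; $\mathcal E_v$: (vertical) edges joining $\mathbf u$ and $\mathbf ui$; $\mathcal E_h$ (horizontal edges): pairs $(\mathbf u,\mathbf v)$, $\mathbf u\ne\mathbf v$ in the same level $\Sigma^n$, with $J_{\mathbf u}\cap J_{\mathbf v}\ne\emptyset$. Simple: a horizontal connected component is a maximal connected horizontal subgraph $T$ of some level $\Sigma^n$. $T\Sigma=\{\mathbf ui:\mathbf u\in T,i\in\Sigma\}$. $T\sim T'$ if there is a bijection $g:T\cup T\Sigma\to T'\cup T'\Sigma$ (as subgraphs of $X$) such that $g,g^{-1}$ preserve vertical and horizontal edges; $[T]$ is called a connected class. $X$ is simple if there are finitely many connected classes $\mathscr T_1,\dots,\mathscr T_\kappa$. Incidence matrix: $A=[a_{ij}]_{\kappa\times\kappa}$, where, for any component $T$ with $[T]=\mathscr T_i$, $a_{ij}$ is the number of horizontal connected components $Z$ of $T\Sigma$ with $[Z]=\mathscr T_j$ (this number being independent of the choice of $T$ in the class). $\mathbf b=[b_1,\dots,b_\kappa]^t$ with $b_i=\#T$ for $[T]=\mathscr T_i$. $A$ is primitive if $A^n>0$ entrywise for some $n>0$. Rearrangeable: a row vector $\mathbf a\in\mathbb Z_{\ge0}^\kappa$ is $(m,\mathbf b)$-rearrangeable if there are an integer $p>0$ and a nonnegative integral $p\times\kappa$ matrix $C$ with $\mathbf a=[1,\dots,1]C$ and $C\mathbf b=[m,\dots,m]^t$. A matrix is $(m,\mathbf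 b)$-rearrangeable if each of its rows is. Lipschitz equivalence: existence of a bijection $\sigma$ and $C>0$ with $C^{-1}|x-y|\le|\sigma(x)-\sigma(y)|\le C|x-y|$ for all $x,y$. *)

(* Defs.v *)
From Stdlib Require Import Relation_Operators.
From mathcomp Require Import all_boot all_order all_algebra.
From mathcomp Require Import all_classical all_reals all_analysis.

Set Implicit Arguments.
Unset Strict Implicit.
Unset Printing Implicit Defensive.

Import Order.TTheory GRing.Theory Num.Theory numFieldNormedType.Exports.

Local Open Scope classical_set_scope.
Local Open Scope card_scope.
Local Open Scope ring_scope.

(* The library norm on 'rV[R]_d is the sup norm; metric notions below use this
   Euclidean norm. Topological notions (compact, closed, bounded) are the
   library's, both norms being equivalent. *)
Definition euclid_norm (R : realType) (d : nat) (x : 'rV[R]_d) : R :=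
  Num.sqrt (\sum_(i < d) x ord0 i ^+ 2).

Definition set_dist (R : realType) (d : nat) (A B : set 'rV[R]_d) : R :=
  inf [set euclid_norm (p.1 - p.2) | p in A `*` B].

Definition lipschitz_equivalent (R : realType) (d d' : nat)
    (K : set 'rV[R]_d) (K' : set 'rV[R]_d') : Prop :=
  exists sigma : 'rV[R]_d -> 'rV[R]_d', set_bij K K' sigma /\
  exists C : R, 0 < C /\ forall x y, K x -> K y ->
    C^-1 * euclid_norm (x - y) <= euclid_norm (sigma x - sigma y) /\
    euclid_norm (sigma x - sigma y) <= C * euclid_norm (x - y).

Record ifs (R : realType) (d m : nat) := Ifs {
  ifs_rot : 'I_m -> 'M[R]_d;
  ifs_trans : 'I_m -> 'rV[R]_d;
  ifs_orthogonal : forall i, ifs_rot i *m (ifs_rot i)^T = 1%:M }.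

(* S_i(x) = r R_i x + d_i; points are row vectors, so matrices act on the
   right. *)
Definition ifs_map (R : realType) (d m : nat) (r : R) (F : ifs R d m)
    (i : 'I_m) (x : 'rV[R]_d) : 'rV[R]_d :=
  r *: (x *m ifs_rot F i) + ifs_trans F i.

Definition self_similar_set (R : realType) (d m : nat) (r : R) (F : ifs R d m)
    (K : set 'rV[R]_d) : Prop :=
  [/\ K !=set0, compact K & K = \bigcup_(i in [set: 'I_m]) ifs_map r F i @` K].

Definition dust_like (R : realType) (d m : nat) (r : R) (F : ifs R d m)
    (K : set 'rV[R]_d) : Prop :=
  forall i j : 'I_m, i != j -> ifs_map r F i @` K `&` ifs_map r F j @` K = set0.

Definition word (m : nat) := seq 'I_m.

Definition level (m n : nat) : set (word m) := [set u | size u = n].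

(* For u = [:: i_1; ...; i_n], foldr gives S_{i_1} (... (S_{i_n} x)). *)
Definition word_map (R : realType) (d m : nat) (r : R) (F : ifs R d m)
    (u : word m) (x : 'rV[R]_d) : 'rV[R]_d :=
  foldr (ifs_map r F) x u.

Definition cell (R : realType) (d m : nat) (r : R) (F : ifs R d m)
    (A : set 'rV[R]_d) (u : word m) : set 'rV[R]_d :=
  word_map r F u @` A.

Definition condition_H (R : realType) (d m : nat) (r : R) (F : ifs R d m)
    (K : set 'rV[R]_d) : Prop :=
  exists c : R, 0 < c /\
  forall (n : nat) (u v : word m), (1 <= n)%N -> level n u -> level n v ->
    cell r F K u `&` cell r F K v = set0 ->
    c * r ^+ n <= set_dist (cell r F K u) (cell r F K v).

Definition bounded_closed_invariant (R : realType) (d m : nat) (r : R)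
    (F : ifs R d m) (J : set 'rV[R]_d) : Prop :=
  [/\ J !=set0, bounded_set J, closed J &
      forall i : 'I_m, ifs_map r F i @` J `<=` J].

Definition vedge (m : nat) (u v : word m) : Prop :=
  exists i : 'I_m, v = rcons u i \/ u = rcons v i.

Definition hedge (R : realType) (d m : nat) (r : R) (F : ifs R d m)
    (J : set 'rV[R]_d) (u v : word m) : Prop :=
  [/\ u != v, size u = size v & cell r F J u `&` cell r F J v !=set0].

(* The vertical edges of an augmented tree depend only on m, so the tree is
   represented below by its horizontal edge relation E. *)

Definition hconnected (m : nat) (E : word m -> word m -> Prop)
    (T : set (word m)) : Prop :=
  T !=set0 /\
  forall u v, T u -> T v ->
    clos_refl_trans _ (fun x y => [/\ T x, T y & E x y]) u v.

Definition hcomponent_in (m : nat) (E : word m -> word m -> Prop)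
    (L T : set (word m)) : Prop :=
  [/\ T `<=` L, hconnected E T &
      forall T', T' `<=` L -> hconnected E T' -> T `<=` T' -> T' = T].

Definition hcomponent (m : nat) (E : word m -> word m -> Prop)
    (T : set (word m)) : Prop :=
  exists n : nat, hcomponent_in E (level n) T.

Definition offspring (m : nat) (T : set (word m)) : set (word m) :=
  [set w | exists u i, T u /\ w = rcons u i].

Definition component_equiv (m : nat) (E : word m -> word m -> Prop)
    (T T' : set (word m)) : Prop :=
  exists g : word m -> word m,
    set_bij (T `|` offspring T) (T' `|` offspring T') g /\
    forall u v, (T `|` offspring T) u -> (T `|` offspring T) v ->
      (vedge u v <-> vedge (g u) (g v)) /\ (E u v <-> E (g u) (g v)).

Definition connected_class (m : nat) (E : word m -> word m -> Prop)
    (T : set (word m)) : set (set (word m)) :=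
  [set T' | hcomponent E T' /\ component_equiv E T T'].

Definition connected_classes (m : nat) (E : word m -> word m -> Prop) :
    set (set (set (word m))) :=
  [set connected_class E T | T in hcomponent E].

Definition simple_tree (m : nat) (E : word m -> word m -> Prop) : Prop :=
  finite_set (connected_classes E).

Definition class_enumeration (m : nat) (E : word m -> word m -> Prop)
    (kappa : nat) (tau : 'I_kappa -> set (set (word m))) : Prop :=
  set_bij [set: 'I_kappa] (connected_classes E) tau.

(* That the count does not depend on the component T chosen in its class is
   part of this predicate. *)
Definition incidence_matrix (m : nat) (E : word m -> word m -> Prop)
    (kappa : nat) (tau : 'I_kappa -> set (set (word m)))
    (A : 'M[nat]_kappa) : Prop :=
  forall (T : set (word m)) (i j : 'I_kappa),
    hcomponent E T -> connected_class E T = tau i ->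
    [set Z | hcomponent_in E (offspring T) Z /\ connected_class E Z = tau j]
      #= `I_(A i j).

Definition cardinality_vector (m : nat) (E : word m -> word m -> Prop)
    (kappa : nat) (tau : 'I_kappa -> set (set (word m)))
    (b : 'cV[nat]_kappa) : Prop :=
  forall (T : set (word m)) (i : 'I_kappa),
    hcomponent E T -> connected_class E T = tau i -> T #= `I_(b i ord0).

Definition primitive_mx (kappa : nat) (A : 'M[nat]_kappa) : Prop :=
  exists n : nat, (0 < n)%N /\ forall i j, (0 < (A ^+ n) i j)%N.

Definition rearrangeable_row (kappa m : nat) (b : 'cV[nat]_kappa)
    (a : 'rV[nat]_kappa) : Prop :=
  exists (p : nat) (C : 'M[nat]_(p, kappa)),
    [/\ (0 < p)%N, a = const_mx 1%N *m C & C *m b = const_mx m].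

Definition rearrangeable (kappa m : nat) (b : 'cV[nat]_kappa)
    (A : 'M[nat]_kappa) : Prop :=
  forall i, rearrangeable_row m b (row i A).

Definition lipschitz_equivalent_dust_like (R : realType) (d d' m : nat) (r : R)
    (K : set 'rV[R]_d) (K' : set 'rV[R]_d') : Prop :=
  lipschitz_equivalent K K' /\
  exists (e : nat) (G : ifs R e m) (D : set 'rV[R]_e),
    [/\ self_similar_set r G D, dust_like r G D,
        lipschitz_equivalent K D & lipschitz_equivalent K' D].

(* Main.v *)
From Stdlib Require Import Relation_Operators Operators_Properties.
Require Import Defs.
From mathcomp Require Import all_boot all_order all_algebra fingroup perm.
From mathcomp Require Import all_classical all_reals all_analysis.
From mathcomp Require Import ring lra zify.

Set Implicit Arguments.
Unset Strict Implicit.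
Unset Printing Implicit Defensive.

Import Order.TTheory GRing.Theory Num.Theory numFieldNormedType.Exports.

Local Open Scope classical_set_scope.
Local Open Scope card_scope.
Local Open Scope ring_scope.

(** Under condition (H), the attractor [K] is, up to a bi-Lipschitz change of
    metric, the boundary of the tree whose vertices are the horizontal
    components: two points of [K] that lie under the same component at level [n]
    are at distance at most a multiple of [r ^+ n], because there are finitely
    many classes and hence components have bounded size; points under different
    components of level [n] are at distance at least a multiple of [r ^+ n]
    ([class_cell_structure]). For a dust-like set all components are single
    words, and the tree is the [m]-ary tree of all words.

    It remains to compare the tree of components with the [m]-ary tree. Suppose
    that for some [k > 0] and every component [T] the components lying [k] levels
    below [T] can be grouped into [#|T|] groups of [m ^ k] words each. Give all
    the words of the [j]-th group the [j]-th word of [T] as new ancestor. Doing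
    this on all levels [n * k] yields bijections [block_code] from the words of
    length [n * k] to themselves which turn components into sets of words with a
    common [k]-th ancestor and which respect the passage to ancestors up to
    components. They induce a bijection of the two boundaries that changes the
    separation level by at most one block of [k] levels, that is, a bi-Lipschitz
    bijection ([lipschitz_equivalent_of_matching]).

    Rearrangeability of the incidence matrix provides such groupings for [k = 1]
    ([packable_of_rearrangeable]). If the matrix is primitive then,
    for large [k], there are very many components with a single word [k] levels
    below any component, since the root is one; filling the groups greedily with
    the larger components and then with the singletons gives exact groupings
    ([packable_of_primitive]).

    Both attractors are compared with one and the same dust-like set
    ([exists_dust_like]), so they are equivalent to each other too. *)

(** * The Euclidean norm and bi-Lipschitz relations *)

Section Norm.
Variables (R : realType) (d : nat).
Implicit Types x y : 'rV[R]_d.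

Lemma euclid_norm_ge0 x : 0 <= euclid_norm x.
Proof. exact: sqrtr_ge0. Qed.

Lemma euclid_norm0 : euclid_norm (0 : 'rV[R]_d) = 0.
Proof. by rewrite /euclid_norm big1 ?sqrtr0 // => i _; rewrite mxE expr0n. Qed.

Lemma norm_coord_le_euclid x i : `|x ord0 i| <= euclid_norm x.
Proof.
have sq_ge0 : 0 <= \sum_(i < d) x ord0 i ^+ 2.
  by apply: sumr_ge0 => j _; apply: sqr_ge0.
rewrite -sqrtr_sqr ler_sqrt // (bigD1 i) //= lerDl.
by apply: sumr_ge0 => j _; apply: sqr_ge0.
Qed.

Lemma euclid_norm_eq0 x : euclid_norm x = 0 -> x = 0.
Proof.
move=> x0; apply/rowP => i; rewrite mxE; apply/normr0_eq0/le_anti.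
by rewrite normr_ge0 -x0 norm_coord_le_euclid.
Qed.

Lemma mx_norm_le_euclid x : `|x| <= euclid_norm x.
Proof.
rewrite -[`|x|]/(mx_norm x) mx_normrE.
apply/bigmax_leP; split => [|[i j] _ /=]; first exact: euclid_norm_ge0.
by rewrite ord1 norm_coord_le_euclid.
Qed.

Lemma coord_le_mx_norm x i : `|x ord0 i| <= `|x|.
Proof.
rewrite -[`|x|]/(mx_norm x) mx_normrE.
exact: (le_bigmax _ (fun p : 'I_1 * 'I_d => `|x p.1 p.2|) (ord0, i)).
Qed.

(** Together with [mx_norm_le_euclid] this makes the two norms comparable, so
    that triangle inequalities can be taken in the sup norm. *)
Lemma euclid_le_mx_norm x : euclid_norm x <= d%:R * `|x|.
Proof.
have dx0 : 0 <= d%:R * `|x| :> R by rewrite mulr_ge0.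
rewrite -[leRHS](ger0_norm dx0) -sqrtr_sqr ler_sqrt ?sqr_ge0 // exprMn.
apply: le_trans (_ : \sum_(i < d) `|x| ^+ 2 <= _).
  apply: ler_sum => i _.
  by rewrite -real_normK ?num_real // lerXn2r ?nnegrE // coord_le_mx_norm.
rewrite sumr_const card_ord -[_ *+ d]mulr_natl ler_wpM2r ?sqr_ge0//.
by rewrite -natrX ler_nat; case: (d) => [|k] //; rewrite -mulnn leq_pmulr.
Qed.

Lemma closure_euclid (A : set 'rV[R]_d) x :
  closure A x <-> forall e, 0 < e -> exists2 a, A a & euclid_norm (a - x) < e.
Proof.
split=> [clA e e0|H B /nbhs_ballP[e /= e0 xeB]].
  pose e' := e / d.+1%:R; have e'0 : 0 < e' by rewrite divr_gt0.
  have [a [Aa]] := clA _ (nbhsx_ballx x e' e'0).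
  rewrite -ball_normE /= distrC ltr_pdivlMr // mulrC => lt_e; exists a => //.
  apply: le_lt_trans (euclid_le_mx_norm _) _; apply: le_lt_trans lt_e.
  by rewrite ler_wpM2r // ler_nat.
have [a Aa ax] := H _ e0; exists a; split=> //; apply: xeB.
by rewrite -ball_normE /= distrC; apply: le_lt_trans (mx_norm_le_euclid _) _.
Qed.

End Norm.

Section Bilipschitz.
Variables (R : realType).

(** A relation that distorts distances by a bounded factor in both directions
    is automatically the graph of a bijection: related points at distance 0
    coincide on both sides. *)
Lemma lipschitz_of_relation d d' (K : set 'rV[R]_d) (K' : set 'rV[R]_d')
    (P : 'rV[R]_d -> 'rV[R]_d' -> Prop) (C : R) :
  0 < C ->
  (forall x, K x -> exists2 y, K' y & P x y) ->
  (forall y, K' y -> exists2 x, K x & P x y) ->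
  (forall x x' y y', K x -> K x' -> K' y -> K' y' -> P x y -> P x' y' ->
     euclid_norm (x - x') <= C * euclid_norm (y - y') /\
     euclid_norm (y - y') <= C * euclid_norm (x - x')) ->
  lipschitz_equivalent K K'.
Proof.
move=> C0 Ptot Psurj PC.
have /choice[f fP] x : exists y, K x -> K' y /\ P x y.
  have [/Ptot[y Ky Pxy]|nKx] := pselect (K x); first by exists y.
  by exists 0.
have fC x x' : K x -> K x' ->
    euclid_norm (x - x') <= C * euclid_norm (f x - f x') /\
    euclid_norm (f x - f x') <= C * euclid_norm (x - x').
  by move=> Kx Kx'; have [??] := fP _ Kx; have [??] := fP _ Kx'; apply: PC.
exists f; split; last first.
  exists C; split=> // x y Kx Ky; have [le1 le2] := fC _ _ Kx Ky; split=> //.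
  by rewrite mulrC ler_pdivrMr // mulrC.
split=> [x /fP[]//|x x' /set_mem Kx /set_mem Kx' fxx'|y Ky].
  have [+ _] := fC _ _ Kx Kx'; rewrite fxx' subrr euclid_norm0 mulr0 => le0.
  apply/eqP; rewrite -subr_eq0; apply/eqP/euclid_norm_eq0/le_anti.
  by rewrite le0 euclid_norm_ge0.
have [x Kx Pxy] := Psurj _ Ky; exists x => //; have [Kfx Pfx] := fP _ Kx.
have [_] := PC _ _ _ _ Kx Kx Ky Kfx Pxy Pfx.
rewrite subrr euclid_norm0 mulr0 => le0; apply/esym/eqP; rewrite -subr_eq0.
by apply/eqP/euclid_norm_eq0/le_anti; rewrite le0 euclid_norm_ge0.
Qed.

Lemma lipschitz_equivalent_via d d' e (K : set 'rV[R]_d) (K' : set 'rV[R]_d')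
    (D : set 'rV[R]_e) :
  lipschitz_equivalent K D -> lipschitz_equivalent K' D ->
  lipschitz_equivalent K K'.
Proof.
move=> [f [[fun_f _ surj_f] [C [C0 fC]]]] [g [[fun_g _ surj_g] [B [B0 gB]]]].
apply: (@lipschitz_of_relation _ _ _ _ (fun x y => f x = g y) (C * B)).
- exact: mulr_gt0.
- by move=> x Kx; have [y ? <-] := surj_g _ (fun_f _ Kx); exists y.
- by move=> y Ky; have [x ? <-] := surj_f _ (fun_g _ Ky); exists x.
move=> x x' y y' Kx Kx' Ky Ky' fg fg'.
have [f1 f2] := fC _ _ Kx Kx'; have [g1 g2] := gB _ _ Ky Ky'.
move: f1 f2; rewrite fg fg' => f1 f2.
have {}f1 : euclid_norm (x - x') <= C * euclid_norm (g y - g y').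
  by move: f1; rewrite mulrC ler_pdivrMr // [leRHS]mulrC.
have {}g1 : euclid_norm (y - y') <= B * euclid_norm (g y - g y').
  by move: g1; rewrite mulrC ler_pdivrMr // [leRHS]mulrC.
split.
  by rewrite -mulrA; apply: le_trans f1 _; rewrite ler_wpM2l // ltW.
rewrite [C * B]mulrC -mulrA; apply: le_trans g1 _.
by rewrite ler_wpM2l // ltW.
Qed.

Lemma expr_archi (r : R) (e : R) : 0 < r < 1 -> 0 < e -> exists n, r ^+ n < e.
Proof.
move=> /andP[r0 r1] e0.
have := @cvg_expr R r; rewrite ger0_norm ?ltW // => /(_ r1) /cvgrPdist_lt /(_ _ e0).
case=> n _ /(_ n (leqnn _)) /=; rewrite sub0r normrN ger0_norm ?exprn_ge0 ?ltW //.
by exists n.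
Qed.

(** Comparing two distances scale by scale is enough: if [a > 0], take the
    largest scale [c * rho ^+ n] not exceeding [a]; the hypothesis at the scale
    just above bounds [b], or the bound [C] does if [n = 0], and consecutive
    scales differ by the factor [rho]. If [a = 0], the hypothesis at all scales
    forces [b = 0]. *)
Lemma le_of_scales (rho c C a b : R) :
  0 < rho < 1 -> 0 < c -> 0 <= a -> 0 <= b <= C ->
  (forall n, a < c * rho ^+ n -> b <= C * rho ^+ n) ->
  b <= C / (c * rho) * a.
Proof.
move=> rho01 c0 a0 /andP[b0 bC] H; have /andP[r0 r1] := rho01.
have C0 : 0 <= C by apply: le_trans bC.
have [a_eq0|a_neq0] := eqVneq a 0.
  rewrite a_eq0 mulr0 leNgt; apply/negP => b_gt0.
  have C_gt0 : 0 < C by apply: lt_le_trans bC.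
  have [n] := expr_archi rho01 (divr_gt0 b_gt0 C_gt0).
  rewrite ltr_pdivlMr // mulrC ltNge H // a_eq0 mulr_gt0 // exprn_gt0 //.
have a_gt0 : 0 < a by rewrite lt_def a_neq0.
have [n0 Hn0] := expr_archi rho01 (divr_gt0 a_gt0 c0).
have exn : exists n, c * rho ^+ n <= a.
  by exists n0; rewrite mulrC -ler_pdivlMr // ltW.
have crho : 0 < c * rho by rewrite mulr_gt0.
rewrite mulrAC ler_pdivlMr //.
case: (ex_minnP exn) => -[|n] le_n min_n.
  apply: (@le_trans _ _ (C * c)).
    by apply: ler_pM => //; [rewrite ltW|rewrite -[leRHS]mulr1 ler_wpM2l// ltW].
  by rewrite ler_wpM2l //; move: le_n; rewrite expr0 mulr1.
have lt_n : a < c * rho ^+ n.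
  by rewrite ltNge; apply/negP => /min_n; rewrite ltnn.
apply: (@le_trans _ _ (C * rho ^+ n * (c * rho))).
  by rewrite ler_wpM2r ?H // ltW.
rewrite -mulrA ler_wpM2l // mulrCA [rho ^+ n * rho]mulrC -exprS //.
Qed.

End Bilipschitz.

(** * Trees of components, cell structures and rearrangements *)

Section LevelEquivalence.
Variables (m : nat).

(** The equivalence classes model the horizontal components of all levels at
    once; the last field makes the components into a tree. *)
Record level_equivalence (conn : word m -> word m -> Prop) : Prop := {
  conn_refl : forall u, conn u u;
  conn_sym : forall u v, conn u v -> conn v u;
  conn_trans : forall u v w, conn u v -> conn v w -> conn u w;
  conn_size : forall u v, conn u v -> size u = size v;
  conn_parent : forall u v i j, conn (rcons u i) (rcons v j) -> conn u v }.

Lemma level_equivalence_eq : level_equivalence eq.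
Proof. by split=> // [u v w -> ->|u v ->|u v i j /rcons_inj[->]]. Qed.

Variable conn : word m -> word m -> Prop.
Hypothesis lvl : level_equivalence conn.

Lemma conn_take n u v : conn u v -> conn (take n u) (take n v).
Proof.
elim/last_ind: u v => [|u i IH] v.
  by move=> uv; have := conn_size lvl uv; case: v uv.
case/lastP: v => [|v j] uv; first by have := conn_size lvl uv; rewrite size_rcons.
have := conn_size lvl uv; rewrite !size_rcons => -[suv].
have [le_n|lt_n] := leqP n (size u).
  by rewrite -!cats1 !takel_cat -?suv //; apply: IH; apply: conn_parent uv.
by rewrite !take_oversize // size_rcons -?suv.
Qed.

(** A rearrangement of the tree of words, [k] generations at a time. A word
    [w] gets a new ancestor [G w] and a new suffix [h w], and the pair
    determines [w]. The new ancestor lies in the component of the true one, and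
    a whole component is given a single ancestor: this turns components into
    sets of siblings. *)
Record block_matching (k : nat) (G h : word m -> word m) : Prop := {
  bm_conn : forall w, (k <= size w)%N -> conn (G w) (take (size w - k) w);
  bm_size : forall w, (k <= size w)%N -> size (h w) = k;
  bm_const : forall w w', (k <= size w)%N -> conn w w' -> G w = G w';
  bm_inj : forall w w', (k <= size w)%N -> (k <= size w')%N ->
    G w = G w' -> h w = h w' -> w = w';
  bm_surj : forall v z, size z = k ->
    exists w, [/\ size w = (size v + k)%N, G w = v & h w = z] }.

(** The address of [w] in the rearranged tree. *)
Fixpoint block_code (G h : word m -> word m) (n : nat) (w : word m) : word m :=
  if n is n'.+1 then block_code G h n' (G w) ++ h w else [::].

Section BlockCode.
Variables (k : nat) (G h : word m -> word m).
Hypothesis GhP : block_matching k G h.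

Lemma bm_size_parent n w : size w = (n + k)%N -> size (G w) = n.
Proof.
move=> sw; have kw : (k <= size w)%N by rewrite sw leq_addl.
by rewrite (conn_size lvl (bm_conn GhP kw)) size_takel ?leq_subr // sw addnK.
Qed.

Lemma size_block_code n w : size w = (n * k)%N ->
  size (block_code G h n w) = (n * k)%N.
Proof.
elim: n w => [|n IH] w //= sw; rewrite mulSn addnC in sw.
rewrite size_cat IH ?(bm_size_parent sw) // (bm_size GhP) ?sw ?leq_addl //.
by rewrite mulSn addnC.
Qed.

Lemma block_code_inj n w w' : size w = (n * k)%N -> size w' = (n * k)%N ->
  block_code G h n w = block_code G h n w' -> w = w'.
Proof.
elim: n w w' => [|n IH] w w' /=; first by case: w w' => [|??] [].
rewrite mulSn addnC => sw sw' /eqP.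
rewrite eqseq_cat; last first.
  by rewrite !size_block_code // ?(bm_size_parent sw) ?(bm_size_parent sw').
case/andP=> /eqP /IH eG /eqP eh; apply: (bm_inj GhP) => //; rewrite ?sw ?sw' ?leq_addl //.
by apply: eG; rewrite ?(bm_size_parent sw) ?(bm_size_parent sw').
Qed.

Lemma block_code_surj n z : size z = (n * k)%N ->
  exists2 w, size w = (n * k)%N & block_code G h n w = z.
Proof.
elim: n z => [|n IH] z sz; first by exists [::] => //; case: z sz.
rewrite mulSn addnC in sz.
have [|v sv cv] := IH (take (n * k) z); first by rewrite size_takel // sz leq_addr.
have [|w [sw Gw hw]] := bm_surj GhP v (z := drop (n * k) z).
  by rewrite size_drop sz addKn.
exists w; first by rewrite sw sv mulSn addnC.
by rewrite /= Gw hw cv cat_take_drop.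
Qed.

Lemma take_block_code n w : size w = (n.+1 * k)%N ->
  take (n * k) (block_code G h n.+1 w) = block_code G h n (G w).
Proof.
rewrite mulSn addnC => sw /=.
by rewrite take_size_cat // size_block_code // (bm_size_parent sw).
Qed.

End BlockCode.
End LevelEquivalence.

Section CellStructure.
Variables (R : realType) (m : nat) (r : R).

(** A presentation of [K] as the boundary of the tree of classes of [conn]:
    [Q v] is the part of [K] lying under the class of [v]. The bounds
    [cs_diam] and [cs_sep] say that distances in [K] are comparable with the
    ultrametric [r ^+ n], where [n] is the last level at which two points lie
    under the same class. *)
Record cell_structure (d : nat) (K : set 'rV[R]_d)
    (conn : word m -> word m -> Prop) (Q : word m -> set 'rV[R]_d) : Prop := {
  cs_compact : compact K;
  cs_sub : forall v, Q v `<=` K;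
  cs_nonempty : forall v, Q v !=set0;
  cs_cover : forall n x, K x -> exists2 v, size v = n & Q v x;
  cs_conn : forall u v, conn u v -> Q u `<=` Q v;
  cs_take : forall n v, Q v `<=` Q (take n v);
  cs_diam : exists2 C, 0 < C & forall v x y, Q v x -> Q v y ->
    euclid_norm (x - y) <= C * r ^+ size v;
  cs_sep : exists2 c, 0 < c & forall u v x y, size u = size v ->
    Q u x -> Q v y -> euclid_norm (x - y) < c * r ^+ size u -> conn u v }.

Lemma compact_sequence_cluster d (K : set 'rV[R]_d) (x : nat -> 'rV[R]_d) :
  compact K -> (forall n, K (x n)) ->
  exists2 p, K p & forall n e, 0 < e ->
    exists2 l, (n <= l)%N & euclid_norm (x l - p) < e.
Proof.
move=> /(_ (x @ \oo)) cK Kx.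
have [|p [Kp clp]] := cK _ _; first by exists 0%N => // n _; apply: Kx.
exists p => // n e e0.
pose e' := e / d.+1%:R.
have e'0 : 0 < e' by rewrite divr_gt0.
have [||_ [[l nl <-] xlp]] := clp (x @` [set l | (n <= l)%N]) (ball p e').
- by exists n => // l /= nl; exists l.
- exact: nbhsx_ballx.
exists l => //; apply: le_lt_trans (euclid_le_mx_norm _) _.
move: xlp; rewrite -ball_normE /= distrC ltr_pdivlMr // mulrC; apply: le_lt_trans.
by rewrite ler_wpM2r // ler_nat.
Qed.

Hypothesis r01 : 0 < r < 1.
Let r0 : 0 < r. Proof. by case/andP: r01. Qed.

(** Completeness of the boundary: points chosen in the given cells accumulate at
    some [p], and a cell of level [n * k] containing [p] is close to a chosen
    point, hence belongs to the class of [V n] by [cs_sep]. *)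
Lemma nested_cells_meet d (K : set 'rV[R]_d) conn Q (k : nat) (V : nat -> word m) :
  level_equivalence conn -> cell_structure K conn Q ->
  (forall n, size (V n) = (n * k)%N) ->
  (forall n, conn (take (n * k) (V n.+1)) (V n)) ->
  exists2 x, K x & forall n, Q (V n) x.
Proof.
move=> lvl cs sV nestV.
have QV n l : (n <= l)%N -> Q (V l) `<=` Q (V n).
  move=> /subnK <-; elim: (l - n)%N => [|i IH] //.
  apply: subset_trans IH; rewrite addSn.
  by apply: subset_trans (cs_conn cs (nestV _)); apply: cs_take cs _ _.
have /choice[x Qx] n : exists x, Q (V n) x by have := cs_nonempty cs (V n).
have [|p Kp xp] := compact_sequence_cluster (cs_compact cs) (x := x).
  by move=> n; apply: cs_sub cs _ _ (Qx n).
exists p => // n; have [w sw Qw] := cs_cover cs (n * k) Kp.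
have [c c0 csep] := cs_sep cs.
have [|l nl xlp] := xp n (c * r ^+ (n * k)); first by rewrite mulr_gt0 ?exprn_gt0.
apply: (cs_conn cs (conn_sym lvl _) Qw).
by apply: csep (QV _ _ nl _ (Qx l)) Qw _; rewrite sV.
Qed.

(** Relate [x] to [y] when, at every level [n * k], the code of a word carrying
    [x] is a word carrying [y]. If [x] and [x'] lie under one class at level
    [n.+1 * k] then their words have the same new ancestor, so [y] and [y'] lie
    in one cell of level [n * k]; if [y] and [y'] lie in one cell of level
    [n * k] then [x] and [x'] lie under one class of that level. Both
    distances are therefore comparable. *)
Theorem lipschitz_equivalent_of_matching d e (K : set 'rV[R]_d)
    (D : set 'rV[R]_e) conn Q QD k G h :
  level_equivalence conn -> cell_structure K conn Q ->
  cell_structure D eq QD -> (0 < k)%N -> block_matching conn k G h ->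
  lipschitz_equivalent K D.
Proof.
move=> lvl csK csD k0 GhP.
pose code := block_code G h.
pose P x y := forall n, exists w, [/\ size w = (n * k)%N, Q w x & QD (code n w) y].
have szS n : (n.+1 * k = n * k + k)%N by rewrite mulSn addnC.
have rho01 : 0 < r ^+ k < 1.
  by rewrite exprn_gt0 //= exprn_ilt1 -?lt0n ?ltW //; case/andP: r01.
have sGs n w : size w = (n.+1 * k)%N -> size (G w) = (n * k)%N.
  by rewrite szS => /(bm_size_parent lvl GhP).
have leks n (w : word m) : size w = (n.+1 * k)%N -> (k <= size w)%N.
  by move->; rewrite leq_pmull.
have connG n w : size w = (n.+1 * k)%N -> conn (G w) (take (n * k) w).
  by move=> sw; have := bm_conn GhP (leks _ _ sw); rewrite sw szS addnK.
have [CK CK0 diamK] := cs_diam csK; have [cK cK0 sepK] := cs_sep csK.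
have [CD CD0 diamD] := cs_diam csD; have [cD cD0 sepD] := cs_sep csD.
have codeP n w : size w = (n * k)%N -> size (code n w) = (n * k)%N.
  exact: (size_block_code lvl GhP).
apply: (@lipschitz_of_relation _ _ _ _ _ P
  (Num.max (CK / (cD * r ^+ k)) (CD / ((cK * r ^+ k) * r ^+ k)))).
- by rewrite lt_max; apply/orP; left; rewrite divr_gt0 ?mulr_gt0 ?exprn_gt0.
- move=> x Kx.
  have /choice[V VP] n : exists v, size v = (n * k)%N /\ Q v x.
    by have [v ? ?] := cs_cover csK (n * k) Kx; exists v.
  have sV n : size (V n) = (n * k)%N by case: (VP n).
  have QV n : Q (V n) x by case: (VP n).
  have uniqQ n u v : size u = (n * k)%N -> size v = (n * k)%N ->
      Q u x -> Q v x -> conn u v.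
    move=> su sv Qu Qv; apply: sepK Qu Qv _; first by rewrite su.
    by rewrite subrr euclid_norm0 mulr_gt0 ?exprn_gt0.
  (* Taking the new ancestor one level up makes [W] independent of the choice
     of [V n.+1] in its class, so that the codes of [W] are nested. *)
  pose W n := G (V n.+1).
  have sW n : size (W n) = (n * k)%N by apply: sGs.
  have QW n : Q (W n) x.
    apply: (cs_conn csK (conn_sym lvl (connG _ _ (sV n.+1)))).
    exact: (cs_take csK).
  have [||y Dy QDy] := nested_cells_meet (k := k) (V := fun n => code n (W n))
    (level_equivalence_eq m) csD.
  + by move=> n; apply: codeP.
  + move=> n; rewrite /code (take_block_code lvl GhP) //; congr block_code.
    apply: (bm_const GhP); first exact: (leks n).
    by apply: (uniqQ n.+1).
  by exists y => // n; exists (W n).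
- move=> y Dy.
  have /choice[U UP] n : exists u, size u = (n * k)%N /\ QD u y.
    by have [v ? ?] := cs_cover csD (n * k) Dy; exists v.
  have sU n : size (U n) = (n * k)%N by case: (UP n).
  have QU n : QD (U n) y by case: (UP n).
  have /choice[W WP] n : exists w, size w = (n * k)%N /\ code n w = U n.
    by have [w ? ?] := block_code_surj GhP (sU n); exists w.
  have sW n : size (W n) = (n * k)%N by case: (WP n).
  have cW n : code n (W n) = U n by case: (WP n).
  have [||x Kx QWx] := nested_cells_meet (k := k) (V := W) lvl csK.
  + by [].
  + move=> n; apply: (conn_sym lvl); rewrite (_ : W n = G (W n.+1)); last first.
      apply: (block_code_inj lvl GhP (n := n)) => //; first exact: sGs.
      rewrite -(take_block_code lvl GhP) // -!/(code _ _) !cW.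
      apply: (sepD _ _ _ _ _ (QU n) (@cs_take _ _ _ _ csD (n * k)%N _ _ (QU n.+1))).
        by rewrite size_takel !sU // leq_mul2r leqnSn orbT.
      by rewrite subrr euclid_norm0 mulr_gt0 ?exprn_gt0.
    exact: connG.
  by exists x => // n; exists (W n); rewrite cW.
move=> x x' y y' Kx Kx' Dy Dy' Pxy Pxy'.
have diam0K : euclid_norm (x - x') <= CK.
  have [w [/size0nil-> Qx _]] := Pxy 0%N; have [w' [/size0nil-> Qx' _]] := Pxy' 0%N.
  by have := diamK _ _ _ Qx Qx'; rewrite expr0 mulr1.
have diam0D : euclid_norm (y - y') <= CD.
  have [w [/size0nil-> _ Qx]] := Pxy 0%N; have [w' [/size0nil-> _ Qx']] := Pxy' 0%N.
  by have := diamD _ _ _ Qx Qx'; rewrite expr0 mulr1.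
have estK : euclid_norm (x - x') <= CK / (cD * r ^+ k) * euclid_norm (y - y').
  apply: le_of_scales => //; rewrite ?euclid_norm_ge0 // => n.
  have [w [sw Qw Dw]] := Pxy n; have [w' [sw' Qw' Dw']] := Pxy' n.
  rewrite -exprM mulnC -(codeP _ _ sw) => close.
  have eqw : w = w'.
    apply: (block_code_inj lvl GhP sw sw').
    by apply: sepD Dw Dw' close; rewrite !codeP.
  by rewrite codeP // -sw; apply: diamK; rewrite // eqw.
have estD : euclid_norm (y - y') <= CD / (cK * r ^+ k * r ^+ k) * euclid_norm (x - x').
  apply: le_of_scales => //; rewrite ?euclid_norm_ge0 ?mulr_gt0 ?exprn_gt0 // => n.
  have [w [sw Qw Dw]] := Pxy n.+1; have [w' [sw' Qw' Dw']] := Pxy' n.+1.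
  rewrite -exprM -mulrA -exprD addnC mulnC -szS -sw => close.
  have ww' : conn w w' by apply: sepK Qw Qw' close; rewrite sw.
  have eqG := bm_const GhP (leks _ _ sw) ww'.
  rewrite -(codeP n (G w)); last exact: sGs.
  apply: diamD.
    by rewrite /code -(take_block_code lvl GhP) //; apply: (cs_take csD).
  by rewrite /code eqG -(take_block_code lvl GhP) //; apply: (cs_take csD).
by split; [apply: le_trans estK _|apply: le_trans estD _];
  rewrite ler_wpM2r ?euclid_norm_ge0 // le_max lexx ?orbT.
Qed.

End CellStructure.

(** * Self-similar sets and their augmented trees *)

Section Similitudes.
Variables (R : realType) (d m : nat) (r : R) (F : ifs R d m).
Hypothesis r01 : 0 < r < 1.
Let r0 : 0 < r. Proof. by case/andP: r01. Qed.
Let r1 : r < 1. Proof. by case/andP: r01. Qed.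

Lemma euclid_norm_orthogonal (M : 'M[R]_d) (x : 'rV[R]_d) :
  M *m M^T = 1%:M -> euclid_norm (x *m M) = euclid_norm x.
Proof.
have dotE (y : 'rV[R]_d) : \sum_i y ord0 i ^+ 2 = (y *m y^T) ord0 ord0.
  by rewrite mxE; apply: eq_bigr => i _; rewrite mxE expr2.
move=> MM; rewrite /euclid_norm !dotE trmx_mul mulmxA -(mulmxA x) MM mulmx1 //.
Qed.

Lemma euclid_normZ (a : R) (x : 'rV[R]_d) :
  0 <= a -> euclid_norm (a *: x) = a * euclid_norm x.
Proof.
move=> a0; rewrite /euclid_norm -[X in X * _](ger0_norm a0).
rewrite -sqrtr_sqr -sqrtrM ?sqr_ge0 //.
by rewrite mulr_sumr; congr Num.sqrt; apply: eq_bigr => i _; rewrite mxE exprMn.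
Qed.

Lemma euclid_norm_ifs_map i x y :
  euclid_norm (ifs_map r F i x - ifs_map r F i y) = r * euclid_norm (x - y).
Proof.
rewrite /ifs_map opprD addrACA subrr addr0 -scalerBr -mulmxBl euclid_normZ ?ltW //.
by rewrite euclid_norm_orthogonal // ifs_orthogonal.
Qed.

Lemma ifs_map_surj i x : exists y, ifs_map r F i y = x.
Proof.
exists (r^-1 *: ((x - ifs_trans F i) *m (ifs_rot F i)^T)).
rewrite /ifs_map -scalemxAl scalerA mulfV ?gt_eqF // scale1r -mulmxA.
by rewrite (mulmx1C (ifs_orthogonal F i)) mulmx1 subrK.
Qed.

Lemma euclid_norm_word_map u x y :
  euclid_norm (word_map r F u x - word_map r F u y) =
  r ^+ size u * euclid_norm (x - y).
Proof.
elim: u => [|i u IH] /=; first by rewrite expr0 mul1r.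
by rewrite euclid_norm_ifs_map IH exprS mulrA.
Qed.

Lemma cell_rcons A u i :
  cell r F A (rcons u i) = word_map r F u @` (ifs_map r F i @` A).
Proof.
apply/seteqP; split=> y [x Ax <-].
  by exists (ifs_map r F i x); [exists x|rewrite /word_map foldr_rcons].
by case: Ax => z Az <-; exists z => //; rewrite /word_map foldr_rcons.
Qed.

Lemma cell_nonempty A u : A !=set0 -> cell r F A u !=set0.
Proof. by move=> [x Ax]; exists (word_map r F u x); exists x. Qed.

Lemma cell_subset A B u : A `<=` B -> cell r F A u `<=` cell r F B u.
Proof. exact: image_subset. Qed.

Section Invariant.
Variable A : set 'rV[R]_d.
Hypothesis invA : forall i, ifs_map r F i @` A `<=` A.

Lemma cell_rcons_subset u i : cell r F A (rcons u i) `<=` cell r F A u.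
Proof. by rewrite cell_rcons; apply: image_subset. Qed.

Lemma cell_take_subset n u : cell r F A u `<=` cell r F A (take n u).
Proof.
elim/last_ind: u => [|u i IH] //; have [le_n|lt_n] := leqP n (size u).
  by rewrite -cats1 takel_cat // cats1; apply: subset_trans IH; apply: cell_rcons_subset.
by rewrite take_oversize // size_rcons.
Qed.

Lemma cell_invariant_subset u : cell r F A u `<=` A.
Proof.
move=> x /(@cell_take_subset 0); rewrite take0 => -[y Ay <-] //.
Qed.

End Invariant.

Lemma self_similar_invariant K : self_similar_set r F K ->
  forall i, ifs_map r F i @` K `<=` K.
Proof. by case=> _ _ KE i x Kx; rewrite KE; exists i. Qed.

Lemma self_similar_cover K n x : self_similar_set r F K -> K x ->
  exists2 u : word m, size u = n & cell r F K u x.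
Proof.
move=> [_ _ KE] Kx; elim: n => [|n [u su [y Ky <-]]].
  by exists [::] => //; exists x.
move: Ky; rewrite KE => -[i _ Ky]; exists (rcons u i); first by rewrite size_rcons su.
by rewrite cell_rcons -KE; exists y.
Qed.

Lemma bounded_sets_dist (A B : set 'rV[R]_d) : bounded_set A -> bounded_set B ->
  exists2 C, 0 < C & forall x y, A x -> B y -> euclid_norm (x - y) <= C.
Proof.
move=> /ex_strict_bound_gt0 [a a0 Aa] /ex_strict_bound_gt0 [b b0 Bb].
exists (d%:R * (a + b) + 1); first by rewrite ltr_wpDl // mulr_ge0 // addr_ge0 // ltW.
move=> x y Ax By; apply: le_trans (euclid_le_mx_norm _) _.
rewrite ler_wpDr // ler_wpM2l // (le_trans (ler_normB _ _)) // lerD // ltW //.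
  exact: Aa.
exact: Bb.
Qed.

(** Every point of [K] is within [C * r ^+ n] of the image of a point of [J]
    under a word map of length [n], and that image is in [J]. *)
Lemma attractor_subset_invariant K J : self_similar_set r F K ->
  bounded_closed_invariant r F J -> K `<=` J.
Proof.
move=> ssK [[y0 Jy0] bJ cJ invJ] x Kx; apply: cJ; apply/closure_euclid => e e0.
have bK : bounded_set K by apply: compact_bounded; case: ssK.
have [C C0 JKC] := bounded_sets_dist bJ bK.
have [n rn] := expr_archi r01 (divr_gt0 e0 C0).
have [u su [z Kz <-]] := self_similar_cover n ssK Kx.
exists (word_map r F u y0).
  by apply: (cell_invariant_subset invJ (u := u)); exists y0.
rewrite euclid_norm_word_map su.
apply: (@le_lt_trans _ _ (r ^+ n * C)); last by rewrite -ltr_pdivlMr.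
by rewrite ler_wpM2l ?JKC // exprn_ge0 // ltW.
Qed.

End Similitudes.

Section AugmentedTree.
Variables (R : realType) (d m : nat) (r : R) (F : ifs R d m).
Variables (K J : set 'rV[R]_d).
Hypothesis r01 : 0 < r < 1.
Let r0 : 0 < r. Proof. by case/andP: r01. Qed.

(** Since horizontal edges stay inside a level, the classes of this relation on
    all words are the components of the levels. *)
Definition hconn (E : word m -> word m -> Prop) := clos_refl_trans (word m) E.

Hypothesis invJ : forall i, ifs_map r F i @` J `<=` J.

Lemma hconn_hedge_level_equivalence : level_equivalence (hconn (hedge r F J)).
Proof.
split.
- exact: rt_refl.
- move=> u v; elim=> [{}u {}v [uv suv Juv]|{}u|u1 u2 u3 _ IH1 _ IH2].
  + by apply: rt_step; split; rewrite 1?eq_sym // setIC.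
  + exact: rt_refl.
  + exact: rt_trans IH1.
- by move=> u v w; apply: rt_trans.
- by move=> u v; elim=> [{}u {}v []|//|u1 u2 u3 _ -> _ ->].
suff parent x y : hconn (hedge r F J) x y ->
    hconn (hedge r F J) (take (size x).-1 x) (take (size y).-1 y).
  by move=> u v i j /parent; rewrite !size_rcons /= -!cats1 !take_size_cat.
elim=> [{}x {}y|{}x|x1 x2 x3 _ IH1 _ IH2]; [|exact: rt_refl|exact: rt_trans IH2].
case/lastP: x => [|u i]; case/lastP: y => [|v j]; rewrite /hedge ?size_rcons;
  case=> // uv [suv] [x [Jux Jvx]].
 rewrite /= -!cats1 !take_size_cat //.
have [->|neq] := eqVneq u v; first exact: rt_refl.
apply: rt_step; split=> //; exists x; split.
  exact: (cell_rcons_subset invJ) Jux.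
exact: (cell_rcons_subset invJ) Jvx.
Qed.

Let e n (t t' : n.-tuple 'I_m) : bool := `[< hedge r F J t t' >].

(** On a fixed level the relation is connectedness in a finite graph, which
    gives access to repetition-free paths. *)
Lemma hconn_connect n (t t' : n.-tuple 'I_m) :
  hconn (hedge r F J) t t' <-> connect (@e n) t t'.
Proof.
split; last first.
  move=> /connectP[p + ->]; elim: p t => [|t1 p IH] t /=.
    by move=> _; apply: rt_refl.
  by move=> /andP[/asboolP ett1 /IH]; apply: rt_trans; apply: rt_step.
suff H u v : clos_refl_trans_1n _ (hedge r F J) u v ->
    forall t t' : n.-tuple 'I_m, val t = u -> val t' = v -> connect (@e n) t t'.
  by move=> tt'; apply: H (clos_rt_rt1n _ _ _ _ tt') _ _ _ _.
elim=> [{}u {}t {}t'|x y z xy _ IH {}t {}t' tx t'z].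
  by move=> <- /val_inj ->; apply: connect0.
have sy : size y == n by case: xy => _ <- _; rewrite -tx size_tuple.
apply: (connect_trans (y := Tuple sy)); last exact: IH.
by apply: connect1; apply/asboolP; rewrite tx.
Qed.

(** Consecutive cells of a path meet, so a path of [size p] edges spans at most
    [(size p).+1] cell diameters. *)
Lemma path_cell_dist n (t : n.-tuple 'I_m) p (C : R) (x y : 'rV[R]_d) :
  (forall u (x y : 'rV[R]_d), cell r F J u x -> cell r F J u y ->
     `|x - y| <= C * r ^+ size u) ->
  path (@e n) t p -> cell r F J t x -> cell r F J (last t p) y ->
  `|x - y| <= (size p).+1%:R * (C * r ^+ n).
Proof.
move=> JC; elim: p t x => [|t1 p IH] t x /=.
  by move=> _ Jx Jy; rewrite mul1r; have := JC t x y Jx Jy; rewrite size_tuple.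
move=> /andP[/asboolP[_ _ [z [Jtz Jt1z]]] pth] Jx Jy.
rewrite -natr1 mulrDl mul1r [leRHS]addrC -(subrKA z); apply: le_trans (ler_normD _ _) _.
by apply: lerD; [have := JC t x z Jx Jtz; rewrite size_tuple|apply: (IH t1)].
Qed.

Definition class_cell (u : word m) : set 'rV[R]_d :=
  [set x | exists2 v, hconn (hedge r F J) u v & cell r F K v x].

Hypothesis ssK : self_similar_set r F K.
Hypothesis HK : condition_H r F K.
Hypothesis bciJ : bounded_closed_invariant r F J.

(** If the components have at most [M] vertices, a repetition-free path inside
    one has fewer than [M] edges, which bounds the diameter of [class_cell] by a
    multiple of [r ^+ n]. For the separation, cells of words in different
    components are disjoint because [K] is contained in [J], and condition (H)
    gives them distance at least [c * r ^+ n]. *)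
Lemma class_cell_structure (M : nat) :
  (forall n (t : n.-tuple 'I_m),
     (#|[set t' : n.-tuple 'I_m | `[< hconn (hedge r F J) t t' >]]%SET| <= M)%N) ->
  cell_structure r K (hconn (hedge r F J)) class_cell.
Proof.
move=> cardM; have lvl := hconn_hedge_level_equivalence.
have KJ : K `<=` J := attractor_subset_invariant r01 ssK bciJ.
have invK := self_similar_invariant ssK.
split.
- by case: ssK.
- by move=> v x [u _ /(cell_invariant_subset invK)].
- move=> v; have [x Kx] : cell r F K v !=set0 by apply: cell_nonempty; case: ssK.
  by exists x, v => //; apply: rt_refl.
- move=> n x /(self_similar_cover n ssK)[u su Kux]; exists u => //.
  by exists u => //; apply: rt_refl.
- move=> u v uv x [w uw Kwx]; exists w => //.
  by apply: (conn_trans lvl) uw; apply: (conn_sym lvl).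
- move=> n v x [w vw Kwx]; exists (take n w); first exact: (conn_take lvl).
  exact: (cell_take_subset invK).
- have bJ : bounded_set J by case: bciJ.
  have [C C0 JC] := bounded_sets_dist bJ bJ.
  have JuC u x y : cell r F J u x -> cell r F J u y -> `|x - y| <= C * r ^+ size u.
    move=> [x' Jx' <-] [y' Jy' <-]; apply: le_trans (mx_norm_le_euclid _) _.
    by rewrite euclid_norm_word_map // mulrC ler_wpM2r ?exprn_ge0 ?JC // ltW.
  exists (d%:R * M%:R * C + 1).
    by rewrite ltr_wpDl // !mulr_ge0 // ltW.
  move=> v x y [u vu Kux] [w vw Kwy].
  have su := conn_size lvl vu; have sw := conn_size lvl vw.
  pose tu := Tuple (introT eqP (esym su)); pose tw := Tuple (introT eqP (esym sw)).
  have : connect (@e (size v)) tu tw.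
    by apply/hconn_connect; apply: (conn_trans lvl) vw; apply: (conn_sym lvl).
  move=> /connectP[p0 pth0 lastp].
  case/shortenP: pth0 lastp => p pth uniqp _ lastp.
  have sizep : (size p < M)%N.
    apply: leq_trans (cardM _ tu); rewrite -[(size p).+1]/(size (tu :: p)).
    rewrite -(card_uniqP uniqp); apply/subset_leq_card/fintype.subsetP => t tp.
    rewrite inE; apply/asboolP/hconn_connect.
    by apply: (path_connect pth).
  have xy : `|x - y| <= M%:R * (C * r ^+ size v).
    apply: le_trans (_ : (size p).+1%:R * (C * r ^+ size v) <= _).
      apply: (path_cell_dist (t := tu)) => //; first exact: (cell_subset KJ).
      by rewrite -lastp; apply: (cell_subset KJ).
    by rewrite ler_wpM2r ?ler_nat // mulr_ge0 ?exprn_ge0 // ltW.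
  apply: le_trans (euclid_le_mx_norm _) _.
  apply: le_trans (_ : d%:R * (M%:R * (C * r ^+ size v)) <= _).
    by rewrite ler_wpM2l.
  by rewrite !mulrA ler_wpM2r ?exprn_ge0 ?lerDl // ltW.
have [c [c0 Hc]] := HK; exists c => // u v x y suv [u' uu' Ku'] [v' vv' Kv'] lt_xy.
apply: contrapT => nuv.
have nuv' : ~ hconn (hedge r F J) u' v'.
  move=> u'v'; apply: nuv; apply: (conn_trans lvl) uu' _.
  by apply: (conn_trans lvl) u'v' _; apply: (conn_sym lvl).
have su' := conn_size lvl uu'; have sv' := conn_size lvl vv'.
have disj : cell r F K u' `&` cell r F K v' = set0.
  rewrite -subset0 => z [Ku'z Kv'z]; apply: nuv'.
  have [->|neq] := eqVneq u' v'; first exact: rt_refl.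
  apply: rt_step; split=> //; first by rewrite -su' -sv'.
  by exists z; split; apply: (cell_subset KJ).
have u'_gt0 : (1 <= size u')%N.
  case: (u') nuv' su' => [|//] nuv' /= su'; case: (v') nuv' sv' => [|? ?].
    by case; apply: rt_refl.
  by move=> _; rewrite -suv su'.
have := Hc _ _ _ u'_gt0 erefl (etrans (esym sv') (etrans (esym suv) su')) disj.
rewrite leNgt => /negP; apply; rewrite -su'; apply: le_lt_trans lt_xy.
apply: ge_inf; last by exists (x, y).
by exists 0 => _ [[a b] _ <-]; apply: euclid_norm_ge0.
Qed.

End AugmentedTree.

(** * A dust-like self-similar set of given ratio *)

Section DustLike.
Variables (R : realType) (m n : nat) (r : R).
Hypothesis r01 : 0 < r < 1.
Hypothesis m_gt0 : (0 < m)%N.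
Hypothesis rnm : r ^+ n.+1 * m%:R < 1.
Let r0 : 0 < r. Proof. by case/andP: r01. Qed.
Let r1 : r < 1. Proof. by case/andP: r01. Qed.

Let shift : {perm 'I_n.+1} := perm (@ord_pred_inj n.+1).

Lemma perm_mx_orthogonal (s : {perm 'I_n.+1}) :
  perm_mx s *m (perm_mx s)^T = 1%:M :> 'M[R]_n.+1.
Proof. by rewrite tr_perm_mx -perm_mxM mulgV perm_mx1. Qed.

(** The [i]-th map rotates the coordinates cyclically, scales by [r] and adds
    the digit [i] to coordinate 0. Every coordinate of the attractor is thus a
    digit expansion in base [r ^+ n.+1], so that a large dimension separates
    the pieces however close to 1 the ratio [r] is. *)
Definition digit_ifs : ifs R n.+1 m :=
  Ifs (fun i : 'I_m => i%:R *: delta_mx ord0 ord0)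
      (fun _ : 'I_m => perm_mx_orthogonal shift^-1).

Let S := ifs_map r digit_ifs.

Lemma digit_ifsE i x j : S i x ord0 j =
  if j == ord0 then i%:R + r * x ord0 ord_max else r * x ord0 (ord_pred j).
Proof.
rewrite /S /ifs_map /= -col_permE !mxE eqxx /= permE.
case: eqP => [->|_]; last by rewrite mulr0 addr0.
rewrite mulr1 addrC; congr (_ + _ * x _ _); apply/val_inj => /=.
by rewrite modn_small.
Qed.

(* The sum of the geometric series of largest digits in base [r ^+ n.+1]. *)
Let M := (m%:R - 1) / (1 - r ^+ n.+1).

Let rn1 : r ^+ n.+1 < 1. Proof. by rewrite exprn_ilt1 ?ltW. Qed.
Let ME : (m%:R - 1) + r ^+ n.+1 * M = M.
Proof.
rewrite /M; field.
by rewrite subr_eq0 eq_sym lt_eqF // rn1.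
Qed.
Let M0 : 0 <= M.
Proof. by rewrite divr_ge0 // subr_ge0 ?(ltW rn1) // -[1]/(1%:R) ler_nat. Qed.

(* The largest contribution to coordinate 0 of the digits after the first;
   being below 1, it lets coordinate 0 determine the first digit. *)
Let theta := r ^+ n.+1 * M.
Let theta1 : theta < 1.
Proof.
rewrite /theta /M mulrA ltr_pdivrMr ?subr_gt0 // mul1r mulrBr mulr1 ltrD2r //.
Qed.

Let box (x : 'rV[R]_n.+1) := forall j : 'I_n.+1, 0 <= x ord0 j <= r ^+ j * M.

Lemma box_digit_ifs i x : box x -> box (S i x).
Proof.
move=> bx j; rewrite digit_ifsE; case: eqP => [->|/eqP j0].
  have /andP[x0 xM] := bx ord_max.
  rewrite addr_ge0 ?mulr_ge0 ?ler0n //=; last exact: ltW.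
  rewrite expr0 mul1r -[leRHS]ME lerD //; last first.
    by rewrite exprS -mulrA ler_wpM2l // ltW.
  by rewrite lerBrDr natr1 ler_nat ltn_ord.
have /andP[x0 xM] := bx (ord_pred j).
rewrite mulr_ge0 //=; last exact: ltW.
have -> : r ^+ j * M = r * (r ^+ (ord_pred j) * M); last by rewrite ler_wpM2l // ltW.
rewrite mulrA -exprS; congr (_ ^+ _ * _); rewrite /=.
case: j j0 {x0 xM} => -[|j] //= ltj _.
by rewrite modnDr modn_small // ltnW.
Qed.

Lemma box_separated i j x y : box x -> box y -> i != j ->
  1 - theta <= `|S i x ord0 ord0 - S j y ord0 ord0|.
Proof.
move=> bx by_ ij; rewrite !digit_ifsE eqxx.
have bnd z : box z -> 0 <= r * z ord0 ord_max <= theta.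
  move=> /(_ ord_max)/andP[z0 zM]; rewrite mulr_ge0 //=; last exact: ltW.
  by rewrite /theta exprS -mulrA ler_wpM2l // ltW.
have /andP[x0 x1] := bnd _ bx; have /andP[y0 y1] := bnd _ by_.
have : (i < j)%N || (j < i)%N by rewrite -neq_ltn.
case/orP=> [lt|lt].
  have : i%:R + 1 <= j%:R :> R by rewrite natr1 ler_nat.
  by move=> ?; rewrite ler_normr; apply/orP; right; lra.
have : j%:R + 1 <= i%:R :> R by rewrite natr1 ler_nat.
by move=> ?; rewrite ler_normr; apply/orP; left; lra.
Qed.

Let coordB (x y : 'rV[R]_n.+1) j : (x - y) ord0 j = x ord0 j - y ord0 j.
Proof. by rewrite !mxE. Qed.

Let orbit : set 'rV[R]_n.+1 := [set word_map r digit_ifs u 0 | u in setT].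

(** The origin is the fixed point of the map with digit 0, hence its orbit
    already satisfies the self-similarity equation. *)
Definition dust := closure orbit.

Let S_orbit i x : orbit x -> orbit (S i x).
Proof. by move=> [u _ <-]; exists (i :: u). Qed.

Let orbit_S x : orbit x -> exists i y, orbit y /\ x = S i y.
Proof.
move=> [[|i u] _ <-].
  exists (Ordinal m_gt0), 0; split; first by exists [::].
  by rewrite /S /ifs_map mul0mx scaler0 /= scale0r addr0.
by exists i, (word_map r digit_ifs u 0); split=> //; exists u.
Qed.

Let box_orbit x : orbit x -> box x.
Proof.
move=> [u _ <-]; elim: u => [|i u IH]; last exact: box_digit_ifs.
by move=> j; rewrite mxE lexx mulr_ge0 // exprn_ge0 // ltW.
Qed.

Let box_dust x : dust x -> box x.
Proof.
move=> /closure_euclid dx j; apply/andP; split; rewrite leNgt; apply/negP => lt_j.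
  have [|a /box_orbit/(_ j)/andP[a0 _] ax] := dx (- x ord0 j); first by rewrite oppr_gt0.
  have := le_lt_trans (norm_coord_le_euclid _ j) ax; rewrite coordB ltr_norml => /andP[_ ?].
  lra.
have [|a /box_orbit/(_ j)/andP[_ aM] ax] := dx (x ord0 j - r ^+ j * M).
  by rewrite subr_gt0.
have := le_lt_trans (norm_coord_le_euclid _ j) ax; rewrite coordB ltr_norml => /andP[? _].
lra.
Qed.

(** To split a limit [x] of orbit points into pieces: orbit points close to [x]
    have close coordinates 0, hence the same first digit [i], and [x] is then a
    limit of points of the [i]-th piece. *)
Lemma self_similar_dust : self_similar_set r digit_ifs dust.
Proof.
split.
- by exists 0; apply: subset_closure; exists [::].
- apply: bounded_closed_compact; last exact: closed_closure.
  exists M; split; first exact: num_real.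
  move=> M' MM' x /box_dust bx /=; apply: le_trans (ltW MM').
  rewrite -[`|_|]/(mx_norm x) mx_normrE; apply/bigmax_leP; split=> // -[i j] _ /=.
  rewrite ord1; have /andP[x0 xM] := bx j; rewrite ger0_norm //.
  by apply: le_trans xM _; rewrite ler_piMl // exprn_ile1 // ltW.
apply/seteqP; split=> x; last first.
  move=> [i _ [y /closure_euclid dy <-]]; apply/closure_euclid => e e0.
  have [a oa ay] := dy _ e0; exists (S i a); first exact: S_orbit.
  rewrite euclid_norm_ifs_map //; apply: le_lt_trans ay.
  by rewrite ler_piMl ?euclid_norm_ge0 // ltW.
move=> /closure_euclid dx.
pose e1 := (1 - theta) / 2; have e10 : 0 < e1 by rewrite divr_gt0 // subr_gt0.
have [a oa ax] := dx _ e10; have [i [a' [oa' aE]]] := orbit_S oa.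
have [y yx] := ifs_map_surj digit_ifs r01 i x; exists i => //; exists y => //.
apply/closure_euclid => e e0.
have e'0 : 0 < Num.min e1 (r * e) by rewrite lt_min e10 mulr_gt0.
have [b ob] := dx _ e'0; have [j [b' [ob' bE]]] := orbit_S ob.
rewrite lt_min => /andP[bx1 bx2].
have [eij|neq] := eqVneq i j.
  exists b' => //; move: bx2; rewrite bE -yx -eij euclid_norm_ifs_map //.
  by rewrite ltr_pM2l.
have := box_separated (box_orbit oa') (box_orbit ob') neq.
rewrite -aE -bE => sep.
have := le_lt_trans (norm_coord_le_euclid _ ord0) ax.
have := le_lt_trans (norm_coord_le_euclid _ ord0) bx1.
have /andP[_ e1E] : 0 < e1 <= (1 - theta) / 2 by rewrite e10 lexx.
rewrite !coordB !ltr_norml => /andP[? ?] /andP[? ?].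
by move: sep; rewrite ler_normr => /orP[]; lra.
Qed.

Lemma dust_separated i j x y : dust x -> dust y -> i != j ->
  1 - theta <= euclid_norm (S i x - S j y).
Proof.
move=> /box_dust bx /box_dust by_ ij.
by apply: le_trans (norm_coord_le_euclid _ ord0); rewrite coordB box_separated.
Qed.

Lemma dust_like_dust : dust_like r digit_ifs dust.
Proof.
move=> i j ij; rewrite -subset0 => x [[y dy <-] [z dz zE]].
have := dust_separated dy dz ij; rewrite /S zE subrr euclid_norm0.
by rewrite subr_le0 leNgt theta1.
Qed.

(** Remove the common prefix of [u] and [v], which scales distances by a power
    of [r]; then the first digits differ. *)
Lemma cell_dust_separated u v x y : size u = size v -> u != v ->
  cell r digit_ifs dust u x -> cell r digit_ifs dust v y ->
  (1 - theta) * r ^+ size u <= euclid_norm (x - y).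
Proof.
have sub w z : dust z -> dust (word_map r digit_ifs w z).
  have inv := self_similar_invariant self_similar_dust.
  move=> dz; apply: (cell_invariant_subset inv (u := w)).
  by exists z.
have th0 : 0 <= 1 - theta by rewrite subr_ge0 ltW.
move=> suv neq [x' dx' <-] [y' dy' <-]; elim: u v suv neq => [|i u IH] [|j v] //= [suv].
rewrite eqseq_cons; have [->|ij] := eqVneq i j => /= neq.
  by rewrite euclid_norm_ifs_map // exprS mulrCA ler_wpM2l ?IH // ltW.
move=> {neq}; apply: le_trans (_ : 1 - theta <= _).
  by rewrite ler_piMr // exprn_ile1 // ltW.
by apply: dust_separated ij; apply: sub.
Qed.

Lemma dust_cell_structure : cell_structure r dust eq (cell r digit_ifs dust).
Proof.
have ss := self_similar_dust; have inv := self_similar_invariant ss.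
have cd : compact dust by case: ss.
split=> //.
- by move=> v; apply: cell_invariant_subset.
- by move=> v; apply: cell_nonempty; case: ss.
- by move=> k x; apply: self_similar_cover.
- by move=> u v ->.
- by move=> k v; apply: cell_take_subset.
- have [C C0 CP] := bounded_sets_dist (compact_bounded cd) (compact_bounded cd).
  exists C => // v _ _ [x dx <-] [y dy <-].
  by rewrite euclid_norm_word_map // mulrC ler_wpM2r ?CP // exprn_ge0 // ltW.
exists (1 - theta); first by rewrite subr_gt0.
move=> u v x y suv ux vy; apply: contraPP => /eqP neq.
by apply/negP; rewrite -leNgt; apply: cell_dust_separated ux vy.
Qed.

End DustLike.

Lemma exists_dust_like (R : realType) (m : nat) (r : R) :
  0 < r < 1 -> (0 < m)%N ->
  exists e (G : ifs R e m) D, [/\ self_similar_set r G D, dust_like r G D &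
    cell_structure r D eq (cell r G D)].
Proof.
move=> r01 m0; have m0' : 0 < m%:R :> R by rewrite ltr0n.
have [n rn] := expr_archi r01 (divr_gt0 ltr01 m0').
have rnm : r ^+ n.+1 * m%:R < 1.
  rewrite -ltr_pdivlMr //; apply: le_lt_trans rn; case/andP: r01 => r0 r1.
  by rewrite exprS ler_piMl ?exprn_ge0 // ltW.
exists n.+1, (digit_ifs R m n), (@dust R m n r).
by split; [exact: self_similar_dust|exact: dust_like_dust|exact: dust_cell_structure].
Qed.

(** * Packing components into groups of equal size *)

Section Packing.
Variables (I : eqType) (J : finType) (j0 : J).

Lemma sum_decr (c : J -> nat) j a : (a <= c j)%N ->
  (\sum_i (if i == j then c i - a else c i) = \sum_i c i - a)%N.
Proof.
move=> ac; rewrite (bigD1 j) //= eqxx [in RHS](bigD1 j) //= addnBAC //.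
by congr (_ + _ - _)%N; apply: eq_bigr => i /negbTE ->.
Qed.

Lemma exists_fibers (s : seq I) (c : J -> nat) :
  uniq s -> (\sum_j c j)%N = size s ->
  exists f : I -> J, forall j, count (fun i => f i == j) s = c j.
Proof.
elim: s c => [|x s IH] c /=.
  move=> _ /eqP; rewrite sum_nat_eq0 => /forallP c0; exists (fun=> j0) => j.
  by rewrite (eqP (c0 j)).
move=> /andP[xs us] csum.
have [j cj] : exists j, (0 < c j)%N.
  apply: contrapT => c0; move: csum; rewrite big1 // => j _; apply/eqP.
  by rewrite -leqn0 leqNgt; apply/negP => ?; apply: c0; exists j.
have [|f fc] := IH (fun i => if i == j then c i - 1 else c i)%N us.
  by rewrite sum_decr // csum subn1.
exists (fun i => if i == x then j else f i) => i; rewrite eqxx.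
rewrite (eq_in_count (a2 := fun y => f y == i)); last first.
  by move=> y ys; rewrite ifN //; apply: contraNneq xs => <-.
rewrite fc eq_sym; case: eqP => [->|//]; by rewrite add1n subn1 prednK.
Qed.

(** Bins of capacities [c] can be filled exactly by items of weight at most [M]
    together with enough items of weight 1. As long as at least [#|J| * M]
    units are still to be packed, some bin has room for [M] more, so the large
    items never get stuck; unit items then fill the remaining gaps. *)
Lemma greedy_packing (big ones : seq I) (w : I -> nat) (c : J -> nat) (M : nat) :
  uniq (big ++ ones) -> {in big, forall i, (w i <= M)%N} ->
  (#|J| * M <= size ones)%N ->
  (\sum_j c j = \sum_(i <- big) w i + size ones)%N ->
  exists f : I -> J, forall j,
    (\sum_(i <- big | f i == j) w i + count (fun i => f i == j) ones = c j)%N.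
Proof.
move=> + + Mones; elim: big c => [|x big IH] c /=.
  move=> us _; rewrite big_nil => /(exists_fibers us)[f fc].
  by exists f => j; rewrite big_nil fc.
move=> /andP[xs us] wM; rewrite big_cons => csum.
have [j cj] : exists j, (w x <= c j)%N.
  apply: contrapT => cM.
  have lt_c j : (c j < w x)%N by rewrite ltnNge; apply/negP => ?; apply: cM; exists j.
  have : (\sum_j c j <= \sum_(j : J) (w x).-1)%N.
    by apply: leq_sum => j _; have := lt_c j; case: (w x).
  rewrite sum_nat_const csum => le1.
  have wxM : (w x <= M)%N by apply: wM; rewrite inE eqxx.
  have wx0 : (0 < w x)%N by apply: leq_ltn_trans (lt_c j0).
  have le2 : (#|J| * (w x).-1 <= #|J| * M)%N.
    by rewrite leq_mul2l (leq_trans (leq_pred _) wxM) orbT.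
  have := leq_trans le1 (leq_trans le2 Mones).
  by rewrite leqNgt -[X in (X < _)%N]add0n ltn_add2r ltn_addr.
have [||f fc] := IH (fun i => if i == j then c i - w x else c i)%N us.
- by move=> i ib; apply: wM; rewrite inE ib orbT.
- by rewrite sum_decr // csum -addnA addKn.
exists (fun i => if i == x then j else f i) => i; rewrite big_cons eqxx.
have neqx y : y \in big ++ ones -> (y == x) = false.
  by move=> yb; apply/negP => /eqP yx; rewrite -yx yb in xs.
rewrite (eq_in_count (a2 := fun y => f y == i)); last first.
  by move=> y ys; rewrite neqx // mem_cat ys orbT.
have -> : (\sum_(y <- big | (if y == x then j else f y) == i) w y =
           \sum_(y <- big | f y == i) w y)%N.
  rewrite big_seq_cond [RHS]big_seq_cond; apply: eq_bigl => y.
  by case: (boolP (y \in big)) => // yb; rewrite neqx // mem_cat yb.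
have := fc i; have [->|neq] := eqVneq i j; rewrite ?eqxx.
  by move=> fcj; rewrite -addnA fcj addnC subnK.
by [].
Qed.

End Packing.

Section Distribution.
Variables (m : nat) (conn : word m -> word m -> Prop).
Hypothesis lvl : level_equivalence conn.

Section Level.
Variables (n k : nat) (u : word m).

Definition tuple_class : {set n.-tuple 'I_m} := [set t : n.-tuple 'I_m | `[< conn u t >]].
Definition tuple_descendants : {set (n + k).-tuple 'I_m} :=
  [set w : (n + k).-tuple 'I_m | `[< conn u (take n w) >]].

(** The components lying [k] levels below the component of [u]. *)
Definition tuple_blocks : {set {set (n + k).-tuple 'I_m}} :=
  equivalence_partition (fun w w' : (n + k).-tuple 'I_m => `[< conn w w' >])
    tuple_descendants.

Lemma tuple_blocks_partition : finset.partition tuple_blocks tuple_descendants.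
Proof.
apply: equivalence_partitionP => x y z _ _ _.
split; first exact/asboolP/(conn_refl lvl).
move=> /asboolP xy; apply/asboolP/asboolP; apply: (conn_trans lvl) => //.
exact: (conn_sym lvl).
Qed.

Lemma mem_tuple_blocks (Z : {set (n + k).-tuple 'I_m}) :
  Z \in tuple_blocks ->
  exists2 w, w \in tuple_descendants &
    forall w' : (n + k).-tuple 'I_m, (w' \in Z) = `[< conn w w' >].
Proof.
move=> /imsetP[w wS ->]; exists w => // w'; rewrite !inE.
apply: andb_idl => /asboolP ww'; apply/asboolP.
move: wS; rewrite inE => /asboolP uw; apply: (conn_trans lvl) uw _.
exact: (conn_take lvl).
Qed.

Lemma mem_pblock_tuple (w w' : (n + k).-tuple 'I_m) : w \in tuple_descendants ->
  (w' \in finset.pblock tuple_blocks w) = `[< conn w w' >].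
Proof.
move=> wS; have /and3P[/eqP cov tI _] := tuple_blocks_partition.
have wP : finset.pblock tuple_blocks w \in tuple_blocks by rewrite finset.pblock_mem ?cov.
have [x xS xE] := mem_tuple_blocks wP; rewrite xE.
have : w \in finset.pblock tuple_blocks w by rewrite finset.mem_pblock cov.
rewrite xE => /asboolP xw; apply/asboolP/asboolP; apply: (conn_trans lvl) => //.
exact: (conn_sym lvl).
Qed.

Lemma card_tuple_descendants :
  #|tuple_descendants| = (#|tuple_class| * m ^ k)%N.
Proof.
pose f (p : n.-tuple 'I_m * k.-tuple 'I_m) := [tuple of p.1 ++ p.2].
have f_inj : injective f.
  move=> [a1 a2] [b1 b2] /(congr1 val)/eqP /=.
  rewrite eqseq_cat ?size_tuple // => /andP[/eqP e1 /eqP e2].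
  by congr (_, _); apply: val_inj.
have -> : tuple_descendants = f @: (finset.setX tuple_class [set: k.-tuple 'I_m]).
  apply/setP => w; rewrite inE; apply/asboolP/imsetP => [uw|[[a b]]].
    have s1 : size (take n w) == n by rewrite size_takel // size_tuple leq_addr.
    have s2 : size (drop n w) == k by rewrite size_drop size_tuple addKn.
    exists (Tuple s1, Tuple s2); first by rewrite !inE andbT; apply/asboolP.
    by apply: val_inj; rewrite /= cat_take_drop.
  rewrite !inE andbT => /asboolP ua ->.
  by rewrite /= take_size_cat // size_tuple.
by rewrite card_imset // cardsX cardsT card_tuple card_ord.
Qed.

End Level.
End Distribution.

(** * Rearrangements from packings *)

Section Matching.
Variables (m : nat) (conn : word m -> word m -> Prop).
Hypothesis lvl : level_equivalence conn.
Variable k : nat.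

(** The groups will become the sets of words with a given new [k]-th ancestor.
    Their number [p] is a separate variable because rearrangeability provides the
    groups before it is known that there is one for each word of the component;
    [card_packing] then computes [p]. *)
Definition packable n (u : word m) : Prop :=
  exists (p : nat) (f : {set (n + k).-tuple 'I_m} -> 'I_p),
    p = #|tuple_class conn n u| /\
    forall l : 'I_p,
      (\sum_(Z in tuple_blocks conn n k u | f Z == l) #|Z| = m ^ k)%N.

(** The conditions of [block_matching] for the words whose [k]-th ancestor is
    in [T]. *)
Record local_matching (T : set (word m)) (G h : word m -> word m) : Prop := {
  lm_parent : forall w, (k <= size w)%N -> T (take (size w - k) w) -> T (G w);
  lm_const : forall w w', (k <= size w)%N -> T (take (size w - k) w) ->
    conn w w' -> G w = G w';
  lm_size : forall w, (k <= size w)%N -> T (take (size w - k) w) -> size (h w) = k;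
  lm_inj : forall w w', (k <= size w)%N -> T (take (size w - k) w) ->
    (k <= size w')%N -> T (take (size w' - k) w') -> G w = G w' -> h w = h w' -> w = w';
  lm_surj : forall v z, T v -> size z = k -> exists w,
    [/\ (k <= size w)%N, T (take (size w - k) w), G w = v & h w = z] }.

(** The group of a block chooses its new ancestor. The words sent to a given
    ancestor are then [m ^ k] in number, as many as the words of length [k], and
    are numbered by them. *)
Lemma local_matching_of_packing n (u : word m) : size u = n -> packable n u ->
  exists Gh : (word m -> word m) * (word m -> word m),
    local_matching (conn u) Gh.1 Gh.2.
Proof.
move=> su [p [f [pE fE]]]; subst p.
set S := tuple_descendants conn n k u.
set P := tuple_blocks conn n k u.
have partP : finset.partition P S := tuple_blocks_partition lvl n k u.
have /and3P[/eqP covP trivP _] := partP.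
pose g (w : (n + k).-tuple 'I_m) : n.-tuple 'I_m :=
  enum_val (f (finset.pblock P w)).
pose fib (t : n.-tuple 'I_m) := [set w in S | g w == t].
have gT w : g w \in tuple_class conn n u by apply: enum_valP.
have g_const (w w' : (n + k).-tuple 'I_m) : w \in S -> conn w w' -> g w = g w'.
  move=> wS ww'; congr (enum_val (f _)); apply/esym/same_pblock => //.
  by rewrite mem_pblock_tuple //; apply/asboolP.
have card_fib t : t \in tuple_class conn n u -> #|fib t| = (m ^ k)%N.
  move=> tT; pose l := enum_rank_in tT t.
  rewrite -(fE l) -sum1_card big_mkcondr /=.
  rewrite (eq_bigl (fun w => (w \in S) && (f (finset.pblock P w) == l))); last first.
    move=> w; rewrite inE; congr andb; rewrite /g.
    apply/eqP/eqP => [gt|->]; last by rewrite enum_rankK_in.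
    by apply: enum_val_inj; rewrite enum_rankK_in.
  rewrite (set_partition_big_cond _ partP); apply: eq_bigr => Z ZP.
  have fZ w : w \in Z -> f (finset.pblock P w) = f Z.
    by move=> wZ; rewrite (def_pblock trivP ZP wZ).
  case: eqP => fZl.
    rewrite -[#|Z|]sum1_card; apply: eq_bigl => w.
    by apply: andb_idr => wZ; rewrite fZ // fZl.
  apply: big1 => w /andP[wZ /eqP]; by rewrite fZ.
have card_word : (m ^ k)%N = size (enum {: k.-tuple 'I_m}).
  by rewrite -cardE card_tuple card_ord.
have size_fib t : t \in tuple_class conn n u -> size (enum (fib t)) = (m ^ k)%N.
  by move=> tT; rewrite -cardE card_fib.
pose h (w : (n + k).-tuple 'I_m) : word m :=
  nth [::] (map val (enum {: k.-tuple 'I_m})) (index w (enum (fib (g w)))).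
have h_word w : w \in S -> exists z : k.-tuple 'I_m, h w = z /\
    forall z0, z = nth z0 (enum {: k.-tuple 'I_m}) (index w (enum (fib (g w)))).
  move=> wS; have lt_i : (index w (enum (fib (g w))) < size (enum {: k.-tuple 'I_m}))%N.
    by rewrite -card_word -(size_fib (g w)) // index_mem mem_enum inE wS eqxx.
  case: (enum {: k.-tuple 'I_m}) lt_i @h => // z1 s lt_i h.
  exists (nth z1 (z1 :: s) (index w (enum (fib (g w))))).
  by rewrite /h (nth_map z1) //; split=> // z0; apply: set_nth_default.
have wordP (w : word m) : (k <= size w)%N -> conn u (take (size w - k) w) ->
    exists2 t : (n + k).-tuple 'I_m, w = t & t \in S.
  move=> kw uw; have sw : size w == (n + k)%N.
    have := conn_size lvl uw; rewrite su size_takel ?leq_subr // => ->.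
    by rewrite subnK.
  exists (Tuple sw) => //; rewrite inE; apply/asboolP => /=.
  by move: uw; rewrite (eqP sw) addnK.
pose lift T (F : (n + k).-tuple 'I_m -> T) (d : T) (w : word m) :=
  oapp F d (insub w).
have liftE T (F : _ -> T) d (t : (n + k).-tuple 'I_m) : lift T F d t = F t.
  by rewrite /lift valK.
exists (lift _ (fun t => val (g t)) [::], lift _ h [::]) => /=; split.
- move=> w kw uw; have [t -> _] := wordP w kw uw; rewrite liftE.
  by have := gT t; rewrite inE => /asboolP.
- move=> w w' kw uw ww'; have [t wt tS] := wordP w kw uw.
  have sww' := conn_size lvl ww'.
  have [||t' wt' _] := wordP w'; first by rewrite -sww'.
    by apply: (conn_trans lvl) uw _; rewrite sww'; apply: (conn_take lvl).
  rewrite wt wt' !liftE (g_const _ t') // -wt -wt' //.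
- move=> w kw uw; have [t -> tS] := wordP w kw uw; rewrite liftE.
  by have [z [-> _]] := h_word t tS; rewrite size_tuple.
- move=> w w' kw uw kw' uw'; have [t -> tS] := wordP w kw uw.
  have [t' -> tS'] := wordP w' kw' uw'; rewrite !liftE => /val_inj gg.
  have [z [-> zE]] := h_word t tS; have [z' [-> zE']] := h_word t' tS'.
  move=> /val_inj zz'; congr val.
  have tf : t \in enum (fib (g t)) by rewrite mem_enum inE tS eqxx.
  have tf' : t' \in enum (fib (g t)) by rewrite mem_enum inE tS' gg eqxx.
  rewrite -(nth_index t tf) -(nth_index t tf'); congr nth.
  apply/eqP; rewrite -(nth_uniq z _ _ (enum_uniq {: k.-tuple 'I_m})); last 2 first.
  + by rewrite -card_word -(size_fib (g t)) // index_mem.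
  + by rewrite -card_word -(size_fib (g t)) // index_mem.
  by rewrite -(zE z) gg -(zE' z) zz'.
move=> v z uv sz.
have sv : size v == n by rewrite -(conn_size lvl uv) su.
have sz' : size z == k by rewrite sz.
pose tv := Tuple sv; pose tz := Tuple sz'.
have tvT : tv \in tuple_class conn n u by rewrite inE; apply/asboolP.
have lt_i : (index tz (enum {: k.-tuple 'I_m}) < size (enum (fib tv)))%N.
  by rewrite size_fib // card_word index_mem mem_enum.
have [t0 _] : exists t0, t0 \in fib tv.
  by apply/card_gt0P; rewrite cardE; apply: leq_ltn_trans lt_i.
pose t := nth t0 (enum (fib tv)) (index tz (enum {: k.-tuple 'I_m})).
have : t \in fib tv by rewrite -mem_enum mem_nth.
rewrite inE => /andP[tS /eqP gt].
exists t; rewrite !liftE size_tuple leq_addl addnK; split=> //.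
- by move: tS; rewrite inE => /asboolP.
- by rewrite gt.
have [z' [-> zE]] := h_word t tS.
rewrite (zE tz) gt index_uniq ?enum_uniq // nth_index // mem_enum //.
Qed.

(** Local matchings are chosen for the class of the [k]-th ancestor as a set,
    so that equivalent ancestors use the same one. *)
Lemma block_matching_of_packing : (forall n (u : word m), size u = n -> packable n u) ->
  exists G h, block_matching conn k G h.
Proof.
move=> pack.
have /choice[Gh GhP] (T : set (word m)) :
    exists Gh : (word m -> word m) * (word m -> word m),
      (exists u, T = conn u) -> local_matching T Gh.1 Gh.2.
  have [[u ->]|nT] := pselect (exists u, T = conn u); last by exists (id, id).
  have [Gh ?] := local_matching_of_packing (erefl (size u)) (pack _ u erefl).
  by exists Gh.
have {}GhP u : local_matching (conn u) (Gh (conn u)).1 (Gh (conn u)).2.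
  by apply: GhP; exists u.
have connE u v : conn u v -> conn u = conn v.
  move=> uv; apply/funext => w; apply/propext; split.
    by apply: (conn_trans lvl); apply: (conn_sym lvl).
  exact: (conn_trans lvl).
pose base (w : word m) : word m := take (size w - k) w.
pose G w := (Gh (conn (base w))).1 w; pose h w := (Gh (conn (base w))).2 w.
have baseP w : conn (base w) (base w) by apply: (conn_refl lvl).
have connG w : (k <= size w)%N -> conn (base w) (G w).
  by move=> kw; apply: (lm_parent (GhP _)).
exists G, h; split.
- by move=> w kw; apply: (conn_sym lvl); apply: connG.
- by move=> w kw; apply: (lm_size (GhP (base w))).
- move=> w w' kw ww'; rewrite /G -(connE (base w) (base w')).
    exact: (lm_const (GhP (base w))).
  by rewrite /base (conn_size lvl ww'); apply: (conn_take lvl).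
- move=> w w' kw kw' gg hh.
  have eqb : conn (base w) = conn (base w').
    apply: connE; apply: (conn_trans lvl) (connG _ kw) _; rewrite gg.
    by apply: (conn_sym lvl); apply: connG.
  apply: (lm_inj (GhP (base w))) => //.
  + by rewrite -/(base w') eqb.
  + by move: gg; rewrite /G -eqb.
  + by move: hh; rewrite /h -eqb.
move=> v z sz; have [w [kw vw Gw hw]] := lm_surj (GhP v) (conn_refl lvl v) sz.
have eqb : conn v = conn (base w) by apply: connE.
exists w; split; last 2 first.
- by rewrite /G -eqb.
- by rewrite /h -eqb.
by have := conn_size lvl vw; rewrite size_takel ?leq_subr // => ->; rewrite subnK.
Qed.

End Matching.

(** * Rearrangeable and primitive incidence matrices *)

Section Components.
Variables (m : nat) (E : word m -> word m -> Prop).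
Hypothesis lvl : level_equivalence (hconn E).

Let hconn_eq u v : hconn E u v -> hconn E u = hconn E v :> set (word m).
Proof.
move=> uv; apply/seteqP; split=> w; last exact: (conn_trans lvl).
by apply: (conn_trans lvl); apply: (conn_sym lvl).
Qed.

Lemma hconnected_subset T u : hconnected E T -> T u -> T `<=` hconn E u.
Proof.
move=> [_ conT] Tu v Tv; have := conT _ _ Tu Tv.
elim=> [x y []|x|x y z _ ? _]; last exact: rt_trans.
  by move=> _ _; apply: rt_step.
exact: rt_refl.
Qed.

Lemma hconnected_hconn u : hconnected E (hconn E u).
Proof.
split; first by exists u; apply: rt_refl.
have path x y : hconn E x y -> hconn E u x ->
    clos_refl_trans _ (fun x y => [/\ hconn E u x, hconn E u y & E x y]) x y.
  move=> xy; elim: {xy} (clos_rt_rt1n _ _ _ _ xy) => [z|{}x {}y z xy _ IH] ux.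
    exact: rt_refl.
  have uy : hconn E u y by apply: rt_trans ux (rt_step _ _ _ _ xy).
  by apply: rt_trans (IH uy); apply: rt_step.
move=> v w uv uw; apply: path => //; apply: rt_trans uw.
exact: (conn_sym lvl).
Qed.

(** In a union [L] of components of levels, maximal connected subsets are
    classes: a path between two words of a class stays in that class. *)
Lemma hcomponent_inP (L : set (word m)) Z :
  (forall x y, L x -> hconn E x y -> L y) ->
  hcomponent_in E L Z <-> exists2 w, L w & Z = hconn E w.
Proof.
move=> satL; split=> [[ZL conZ maxZ]|[w Lw ->]].
  have [[w Zw] _] := conZ; exists w; first exact: ZL.
  apply/esym/maxZ; last exact: hconnected_subset.
    by move=> x; apply: satL; apply: ZL.
  exact: hconnected_hconn.
split; first by move=> x; apply: satL.
  exact: hconnected_hconn.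
move=> T TL conT wT; apply/seteqP; split=> //.
by apply: hconnected_subset => //; apply: wT; apply: rt_refl.
Qed.

Lemma hcomponent_hconn u : hcomponent E (hconn E u).
Proof.
exists (size u); apply/hcomponent_inP; last by exists u.
by move=> x y; rewrite /level /= => <- /(conn_size lvl) ->.
Qed.

Lemma hcomponent_offspring u Z :
  hcomponent_in E (offspring (hconn E u)) Z <->
  exists2 w, offspring (hconn E u) w & Z = hconn E w.
Proof.
apply: hcomponent_inP => _ y [v [i [uv ->]]] xy.
case/lastP: y xy => [|w j] xy; first by have := conn_size lvl xy; rewrite size_rcons.
exists w, j; split=> //; apply: rt_trans uv _.
exact: (conn_parent lvl) xy.
Qed.

Variables (kappa : nat) (tau : 'I_kappa -> set (set (word m))).
Variables (A : 'M[nat]_kappa) (b : 'cV[nat]_kappa).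
Hypothesis htau : class_enumeration E tau.
Hypothesis hA : incidence_matrix E tau A.
Hypothesis hb : cardinality_vector E tau b.

Lemma exists_class_index : exists cls : set (word m) -> 'I_kappa,
  forall u, connected_class E (hconn E u) = tau (cls (hconn E u)).
Proof.
have [_ _ tau_surj] := htau.
have [|i0 _ _] := tau_surj (connected_class E (hconn E [::])).
  by exists (hconn E [::]) => //; apply: hcomponent_hconn.
have /choice[cls clsP] (T : set (word m)) : exists i : 'I_kappa,
    hcomponent E T -> connected_class E T = tau i.
  have [cT|nT] := pselect (hcomponent E T); last by exists i0.
  have [|i _ iE] := tau_surj (connected_class E T); first by exists T.
  by exists i.
by exists cls => u; apply: clsP; apply: hcomponent_hconn.
Qed.

Variable cls : set (word m) -> 'I_kappa.
Hypothesis clsE : forall u, connected_class E (hconn E u) = tau (cls (hconn E u)).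

Lemma class_indexE u j :
  connected_class E (hconn E u) = tau j <-> cls (hconn E u) = j.
Proof.
rewrite clsE; split=> [|->//]; have [_ tau_inj _] := htau.
by apply: tau_inj; rewrite inE.
Qed.

Lemma card_of_image (I : finType) (X : {set I}) W (psi : I -> W) (Y : set W) k :
  {in X &, injective psi} -> psi @` [set x | x \in X] = Y -> Y #= `I_k ->
  #|X| = k.
Proof.
move=> psi_inj <-; rewrite (card_eql (inj_card_eq _)); last first.
  by move=> x y /set_mem xX /set_mem yX; apply: psi_inj.
have -> : [set x | x \in X] = (@enum_val _ (mem X)) @` [set: 'I_#|X|].
  apply/seteqP; split=> [x /= xX|_ [i _ <-]]; last exact: enum_valP.
  by exists (enum_rank_in xX x) => //; apply: enum_rankK_in.
rewrite (card_eql (inj_card_eq _)); last by move=> i j _ _; apply: enum_val_inj.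
rewrite card_eq_sym => cX; apply/esym/card_eq_II.
exact: card_eq_trans cX (card_esym card_II).
Qed.

Local Notation conn := (hconn E).

Definition block_words k (Z : {set k.-tuple 'I_m}) : set (word m) :=
  [set val w | w in [set w | w \in Z]].

Lemma block_words_inj k : injective (@block_words k).
Proof.
suff sub (Z Z' : {set k.-tuple 'I_m}) : block_words Z = block_words Z' -> Z \subset Z'.
  by move=> Z Z' ZZ'; apply/eqP; rewrite finset.eqEsubset !sub.
move=> ZZ'; apply/fintype.subsetP => w wZ.
have [w' w'Z /val_inj <-//] : block_words Z' (val w) by rewrite -ZZ'; exists w.
Qed.

Lemma card_block k (Z : {set k.-tuple 'I_m}) u : block_words Z = conn u ->
  #|Z| = b (cls (conn u)) ord0.
Proof.
move=> Zu; apply: (@card_of_image _ Z _ val (conn u)) => //.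
  by move=> x y _ _; apply: val_inj.
by apply: hb; [exact: hcomponent_hconn|exact: clsE].
Qed.

Lemma block_words_tuple_class n u : size u = n ->
  block_words (tuple_class conn n u) = conn u.
Proof.
move=> su; apply/seteqP; split=> [_ [t /= + <-]|v uv]; first by rewrite inE => /asboolP.
have sv : size v == n by rewrite -(conn_size lvl uv) su.
by exists (Tuple sv) => //=; rewrite inE; apply/asboolP.
Qed.

Lemma card_tuple_class n u : size u = n ->
  #|tuple_class conn n u| = b (cls (conn u)) ord0.
Proof. by move=> su; apply/card_block/block_words_tuple_class. Qed.

Lemma block_words_pblock k (w : k.-tuple 'I_m) (Z : {set k.-tuple 'I_m}) :
  (forall w' : k.-tuple 'I_m, (w' \in Z) = `[< conn w w' >]) ->
  block_words Z = conn w.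
Proof.
move=> ZE; apply/seteqP; split=> [_ [t /= + <-]|v wv]; first by rewrite ZE => /asboolP.
have sv : size v == k by rewrite -(conn_size lvl wv) size_tuple.
by exists (Tuple sv) => //=; rewrite ZE; apply/asboolP.
Qed.

Lemma block_words_block n k u Z : Z \in tuple_blocks conn n k u ->
  exists2 w, w \in tuple_descendants conn n k u & block_words Z = conn (val w).
Proof.
by move=> /(mem_tuple_blocks lvl)[w wS /block_words_pblock]; exists w.
Qed.

Lemma offspring_descendants n u w : size u = n ->
  offspring (conn u) w <-> exists2 t, t \in tuple_descendants conn n 1 u & w = val t.
Proof.
move=> su; split=> [[v [i [uv ->]]]|[t + ->]].
  have sv : size v = n by rewrite -(conn_size lvl uv).
  have st : size (rcons v i) == (n + 1)%N by rewrite size_rcons sv addn1.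
  exists (Tuple st) => //; rewrite inE; apply/asboolP => /=.
  by rewrite -cats1 take_size_cat.
rewrite inE => /asboolP uw; have st : size t = n.+1 by rewrite size_tuple addn1.
rewrite -[val t]/(tval t); case/lastP: (tval t) st uw => [//|v i].
rewrite size_rcons => -[sv].
rewrite -cats1 take_size_cat // => uv.
by exists v, i; rewrite cats1.
Qed.

(** The incidence matrix counts sets of words; this transfers the count to the
    finite sets of tuples in which packings are built. *)
Lemma card_blocks_of_class n u j : size u = n ->
  #|[set Z in tuple_blocks conn n 1 u | cls (block_words Z) == j]| = A (cls (conn u)) j.
Proof.
move=> su; apply: (@card_of_image _ _ _ (@block_words (n + 1))); last first.
- by apply: (hA (T := conn u)); [exact: hcomponent_hconn|exact: clsE].
- apply/seteqP; split.
    move=> _ [Z /= + <-]; rewrite inE => /andP[ZP /eqP clsZ].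
    have [w wS Zw] := block_words_block ZP.
    split; last by rewrite Zw; apply/class_indexE; rewrite -Zw.
    apply/hcomponent_offspring; exists (val w) => //.
    by apply/(offspring_descendants _ su); exists w.
  move=> Z [/hcomponent_offspring[w uw ->] /class_indexE clsw].
  move/(offspring_descendants _ su): uw => [t tS wt].
  have Zt := block_words_pblock (fun w' => mem_pblock_tuple lvl w' tS).
  exists (finset.pblock (tuple_blocks conn n 1 u) t); last by rewrite Zt wt.
  rewrite /= inE Zt -wt clsw eqxx andbT finset.pblock_mem //.
  by have /and3P[/eqP -> _ _] := tuple_blocks_partition lvl n 1 u.
by move=> Z Z' _ _; apply: block_words_inj.
Qed.

Hypothesis m_gt0 : (0 < m)%N.

(** Count the words [k] levels below the component of [u] twice. *)
Lemma card_packing n k u p (f : {set (n + k).-tuple 'I_m} -> 'I_p) :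
  (forall l, (\sum_(Z in tuple_blocks conn n k u | f Z == l) #|Z| = m ^ k)%N) ->
  p = #|tuple_class conn n u|.
Proof.
move=> fP; have := card_tuple_descendants conn n k u.
rewrite (card_partition (tuple_blocks_partition lvl n k u)).
rewrite (partition_big f xpredT) //= (eq_bigr _ (fun l _ => fP l)).
rewrite sum_nat_const card_ord => /eqP; rewrite eqn_pmul2r ?expn_gt0 ?m_gt0 //.
by move/eqP.
Qed.

(** For each class [j], the children of class [j] are distributed among the
    rows of the matrix [C] in the numbers given by column [j]; the equation
    [C *m b = const_mx m] says that every group then has [m] words. *)
Lemma packable_of_rearrangeable n u : rearrangeable m b A -> size u = n ->
  packable conn 1 n u.
Proof.
move=> reaA su; have [p [C [p0 rowA CbE]]] := reaA (cls (conn u)).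
set P := tuple_blocks conn n 1 u; pose bl j := [set Z in P | cls (block_words Z) == j].
have /choice[f fP] j : exists f : {set (n + 1).-tuple 'I_m} -> 'I_p, forall l,
    count (fun Z => f Z == l) (enum (bl j)) = C l j.
  apply: (exists_fibers (Ordinal p0)); first exact: enum_uniq.
  rewrite -cardE card_blocks_of_class //.
  have := congr1 (fun a : 'rV_kappa => a ord0 j) rowA; rewrite !mxE => ->.
  by apply: eq_bigr => l _; rewrite mxE; apply/esym/mul1n.
pose g (Z : {set (n + 1).-tuple 'I_m}) := f (cls (block_words Z)) Z.
have gP l : (\sum_(Z in P | g Z == l) #|Z| = m ^ 1)%N.
  have := congr1 (fun a : 'cV_p => a l ord0) CbE; rewrite !mxE expn1; apply: etrans.
  rewrite (partition_big (fun Z => cls (block_words Z)) xpredT) //=.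
  apply: eq_bigr => j _; rewrite -(fP j l).
  rewrite (eq_bigr (fun=> b j ord0)); last first.
    move=> Z /andP[/andP[/block_words_block[w _ Zw] _] /eqP <-].
    by rewrite (card_block Zw) Zw.
  rewrite sum_nat_const; congr (_ * _)%N.
  rewrite -size_filter cardE; apply/perm_size/uniq_perm; first exact: enum_uniq.
    exact/filter_uniq/enum_uniq.
  move=> Z; rewrite [LHS]mem_enum mem_filter mem_enum [in RHS]inE /g.
  rewrite -[LHS]/((Z \in P) && (f (cls (block_words Z)) Z == l) &&
                  (cls (block_words Z) == j)).
  have [->|_] := eqVneq (cls (block_words Z)) j; last by rewrite !andbF.
  by rewrite !andbT andbC.
by exists p, g; split=> //; apply: card_packing gP.
Qed.

Definition singletons n k u : {set (n + k).-tuple 'I_m} :=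
  [set w in tuple_descendants conn n k u |
    `[< forall v, conn (val w) v -> v = val w >]].

(** Greedy packing, the components with a single word being the unit items. *)
Lemma packable_of_singletons n k u M : size u = n ->
  (forall i, b i ord0 <= M)%N ->
  (#|tuple_class conn n u| * M <= #|singletons n k u|)%N ->
  packable conn k n u.
Proof.
move=> su bM leM; set P := tuple_blocks conn n k u.
have partP : finset.partition P (tuple_descendants conn n k u).
  exact: tuple_blocks_partition lvl n k u.
have /and3P[/eqP covP _ _] := partP.
pose ones := [set Z in P | #|Z| == 1]%N; pose big := [set Z in P | #|Z| != 1]%N.
have cls_gt0 : (0 < #|tuple_class conn n u|)%N.
  apply/card_gt0P; have su' : size u == n by rewrite su.
  by exists (Tuple su'); rewrite inE; apply/asboolP/(conn_refl lvl).
have le_ones : (#|singletons n k u| <= #|ones|)%N.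
  rewrite -(card_imset _ (@set1_inj _)); apply/subset_leq_card/fintype.subsetP.
  move=> _ /imsetP[w + ->].
  rewrite inE => /andP[wS /asboolP w1]; rewrite inE cards1 eqxx andbT.
  have -> : [set w]%SET = finset.pblock P w; last by rewrite finset.pblock_mem ?covP.
  apply/setP => w'; rewrite mem_pblock_tuple // finset.in_set1.
  apply/eqP/asboolP => [->|/w1 /val_inj//]; exact: (conn_refl lvl).
have [||||f fP] := @greedy_packing _ _ (Ordinal cls_gt0) (enum big) (enum ones)
    (fun Z : {set (n + k).-tuple 'I_m} => #|Z|) (fun=> m ^ k)%N M.
- rewrite cat_uniq !enum_uniq /= andbT; apply/hasPn => Z.
  by rewrite !mem_enum !inE => /andP[-> ->].
- move=> Z; rewrite mem_enum inE => /andP[/block_words_block[w _ Zw] _].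
  by rewrite (card_block Zw).
- by rewrite card_ord -cardE; apply: leq_trans leM le_ones.
- rewrite sum_nat_const card_ord -card_tuple_descendants (card_partition partP).
  rewrite big_enum -cardE -sum1_card (bigID (fun Z : {set _} => #|Z| != 1%N)) /=.
  congr (_ + _)%N; first by apply: eq_bigl => Z; rewrite inE.
  apply: eq_big => [Z|Z /andP[_ /negPn/eqP//]]; by rewrite inE negbK.
exists #|tuple_class conn n u|, f; split=> // l; rewrite -(fP l).
rewrite (bigID (fun Z : {set _} => #|Z| != 1%N)) /=.
rewrite big_enum_cond -sum1_count big_enum_cond.
congr (_ + _)%N; first by apply: eq_bigl => Z; rewrite inE andbAC.
by apply: eq_big => [Z|Z /andP[_ /negPn/eqP//]]; rewrite inE negbK andbAC.
Qed.

Lemma exists_descendant_of_class N u j : (0 < (A ^+ N) (cls (conn u)) j)%N ->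
  exists w, [/\ size w = (size u + N)%N, conn u (take (size u) w) & cls (conn w) = j].
Proof.
elim: N u => [|N IH] u.
  rewrite expr0 mxE; case: eqP => [<- _|//]; exists u.
  by rewrite addn0 take_size; split=> //; apply: rt_refl.
rewrite exprS mxE => AA.
have [l Al] : exists l, (0 < A (cls (conn u)) l * (A ^+ N) l j)%N.
  apply: contrapT => nl; move: AA; rewrite big1 // => l _; apply/eqP.
  by rewrite -leqn0 leqNgt; apply/negP => ?; apply: nl; exists l.
move: Al; rewrite muln_gt0 -(card_blocks_of_class l (erefl (size u))) => /andP[].
move=> /card_gt0P[Z]; rewrite inE => /andP[/block_words_block[v vS Zv] /eqP clsZ] AN.
rewrite Zv in clsZ; have [|w [sw vw clsw]] := IH (val v); first by rewrite clsZ.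
move: vS; rewrite inE => /asboolP uv.
have svE : size (val v) = (size u).+1 by rewrite size_tuple addn1.
exists w; split=> //; first by rewrite sw svE addSnnS.
apply: (conn_trans lvl) uv _; have := conn_take lvl (size u) vw.
by rewrite svE take_takel.
Qed.

Lemma card_class_root : b (cls (conn [::])) ord0 = 1%N.
Proof.
rewrite -(@card_tuple_class 0 [::]) //; apply/eqP/cards1P; exists [tuple].
by apply/setP => t; rewrite !inE tuple0 eqxx; apply/asboolP/(conn_refl lvl).
Qed.

Lemma hconn_singleton u v : b (cls (conn u)) ord0 = 1%N -> conn u v -> v = u.
Proof.
rewrite -(card_tuple_class (erefl (size u))) => /eqP/cards1P[t tE] uv.
have sv : size v == size u by rewrite (conn_size lvl uv).
have : in_tuple u \in tuple_class conn (size u) u.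
  by rewrite inE; apply/asboolP/(conn_refl lvl).
have : Tuple sv \in tuple_class conn (size u) u by rewrite inE; apply/asboolP.
by rewrite tE !finset.in_set1 => /eqP <- /eqP /(congr1 val).
Qed.

(** Every component has, [N] levels below, components of at least two classes;
    iterating gives exponentially many descendants, each of which has a
    descendant in the class of the root, a class of singletons. *)
Lemma many_singletons N q u : (1 < kappa)%N -> (forall i j, 0 < (A ^+ N) i j)%N ->
  exists s : seq (word m), [/\ uniq s, size s = (2 ^ q)%N & {in s, forall w,
    [/\ size w = (size u + N * q.+1)%N, conn u (take (size u) w) &
        cls (conn w) = cls (conn [::])]}].
Proof.
move=> kappa_gt1 posA; elim: q u => [|q IH] u.
  have [w [sw uw cw]] := exists_descendant_of_class (posA (cls (conn u)) (cls (conn [::]))).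
  by exists [:: w]; split=> // _ /[!inE] /eqP ->; rewrite muln1.
pose i1 : 'I_kappa := Ordinal (ltnW kappa_gt1); pose i2 : 'I_kappa := Ordinal kappa_gt1.
have [u1 [su1 uu1 cu1]] := exists_descendant_of_class (posA (cls (conn u)) i1).
have [u2 [su2 uu2 cu2]] := exists_descendant_of_class (posA (cls (conn u)) i2).
have nu12 : ~ conn u1 u2 by move=> /hconn_eq eqc; move: cu2; rewrite -eqc cu1.
have [s1 [us1 ss1 s1P]] := IH u1; have [s2 [us2 ss2 s2P]] := IH u2.
exists (s1 ++ s2); split.
- rewrite cat_uniq us1 us2 andbT /=; apply/hasPn => w /s2P[_ u2w _].
  apply/negP => /s1P[_ u1w _]; apply: nu12; apply: (conn_trans lvl) u1w _.
  by apply: (conn_sym lvl); rewrite su1 -su2.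
- by rewrite size_cat ss1 ss2 expnS mul2n addnn.
have step v w : size v = (size u + N)%N -> conn u (take (size u) v) ->
    conn v (take (size v) w) -> conn u (take (size u) w).
  move=> sv uv vw; apply: (conn_trans lvl) uv _.
  have := conn_take lvl (size u) vw.
  by rewrite sv take_takel ?leq_addr.
move=> w; rewrite mem_cat => /orP[/s1P|/s2P] [sw vw cw].
  by split=> //; [rewrite sw su1 -addnA -mulnS|exact: step vw].
by split=> //; [rewrite sw su2 -addnA -mulnS|exact: step vw].
Qed.

(** With at least two classes the number of singletons [k] levels below
    eventually exceeds the bound required by the greedy packing. With one
    class, that of the root, all components are singletons. *)
Lemma packable_of_primitive : primitive_mx A ->
  exists2 k, (0 < k)%N & forall n u, size u = n -> packable conn k n u.
Proof.
move=> [N [N0 posA]].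
have [kappa_gt1|kappa_le1] := ltnP 1 kappa.
  pose M := (\max_i b i ord0)%N.
  have bM i : (b i ord0 <= M)%N by apply: leq_bigmax.
  exists (N * (M * M).+1)%N; first by rewrite muln_gt0 N0.
  move=> n u su; apply: (packable_of_singletons su bM).
  have [s [us ss sP]] := many_singletons (M * M) u kappa_gt1 posA.
  apply: leq_trans (_ : M * M <= _)%N.
    by rewrite leq_mul2r card_tuple_class ?bM ?orbT.
  apply: leq_trans (ltnW (ltn_expl _ (ltnSn 1))) _.
  rewrite -ss cardE -(size_map val); apply: uniq_leq_size => // w ws.
  have [sw uw cw] := sP w ws; rewrite su in sw uw; have sw' := introT eqP sw.
  apply/mapP; exists (Tuple sw') => //; rewrite mem_enum inE; apply/andP; split.
    by rewrite inE; apply/asboolP.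
  by apply/asboolP => v; apply: hconn_singleton; rewrite cw card_class_root.
have b1 i : b i ord0 = 1%N.
  apply: etrans card_class_root; congr (b _ _); apply: val_inj.
  by have := ltn_ord i; have := ltn_ord (cls (conn [::])); move=> /=; lia.
exists 1%N => // n u su; apply: (packable_of_singletons (M := 1) su).
  by move=> i; rewrite b1.
rewrite muln1; apply: leq_trans (_ : #|tuple_descendants conn n 1 u| <= _)%N.
  by rewrite card_tuple_descendants expn1 leq_pmulr.
apply/subset_leq_card/fintype.subsetP => w wS; rewrite inE wS; apply/asboolP => v.
exact: hconn_singleton.
Qed.

End Components.

(** * Lipschitz equivalence with a dust-like set *)

Lemma self_similar_alphabet_gt0 (R : realType) (d m : nat) (r : R) (F : ifs R d m) K :
  self_similar_set r F K -> (0 < m)%N.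
Proof.
move=> [[x Kx] _ KE]; move: Kx; rewrite KE => -[i _ _].
by apply: leq_trans (ltn_ord i).
Qed.

(** The target is any set whose words carry disjoint, uniformly separated cells;
    it enters only through its cell structure, hence the same one serves for
    different trees and different block lengths. *)
Theorem lipschitz_equivalent_ultrametric (R : realType) (d m : nat) (r : R)
    (F : ifs R d m) (K J : set 'rV[R]_d) (kappa : nat)
    (tau : 'I_kappa -> set (set (word m))) (A : 'M[nat]_kappa)
    (b : 'cV[nat]_kappa) (e : nat) (D : set 'rV[R]_e)
    (QD : word m -> set 'rV[R]_e) :
  0 < r < 1 -> self_similar_set r F K -> condition_H r F K ->
  bounded_closed_invariant r F J ->
  class_enumeration (hedge r F J) tau ->
  incidence_matrix (hedge r F J) tau A ->
  cardinality_vector (hedge r F J) tau b ->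
  rearrangeable m b A \/ primitive_mx A ->
  cell_structure r D eq QD -> lipschitz_equivalent K D.
Proof.
move=> r01 ssK HK bciJ htau hA hb hAb csD.
have m0 := self_similar_alphabet_gt0 ssK.
have invJ : forall i, ifs_map r F i @` J `<=` J by case: bciJ.
have lvl := hconn_hedge_level_equivalence invJ.
have [cls clsE] := exists_class_index lvl htau.
have csK : cell_structure r K (hconn (hedge r F J)) (class_cell r F K J).
  apply: (class_cell_structure r01 invJ ssK HK bciJ (M := (\max_i b i ord0)%N)) => n t.
  rewrite (card_tuple_class lvl hb clsE (size_tuple t)).
  exact: (leq_bigmax (F := fun i => b i ord0)).
have [k k0 pack] : exists2 k, (0 < k)%N & forall n u, size u = n ->
    packable (hconn (hedge r F J)) k n u.
  case: hAb => [reaA|primA].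
    by exists 1%N => // n u su; apply: (packable_of_rearrangeable lvl htau hA hb clsE).
  exact: (packable_of_primitive lvl htau hA hb clsE).
have [G [h Gh]] := block_matching_of_packing lvl pack.
exact: (lipschitz_equivalent_of_matching r01 lvl csK csD k0 Gh).
Qed.

Theorem theorem3p10 (R : realType) (d d' m : nat) (r : R)
    (F : ifs R d m) (F' : ifs R d' m)
    (K J : set 'rV[R]_d) (K' J' : set 'rV[R]_d')
    (kappa kappa' : nat)
    (tau : 'I_kappa -> set (set (word m)))
    (tau' : 'I_kappa' -> set (set (word m)))
    (A : 'M[nat]_kappa) (A' : 'M[nat]_kappa')
    (b : 'cV[nat]_kappa) (b' : 'cV[nat]_kappa')
    (hr : 0 < r /\ r < 1)
    (hK : self_similar_set r F K) (hK' : self_similar_set r F' K')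
    (hH : condition_H r F K) (hH' : condition_H r F' K')
    (hJ : bounded_closed_invariant r F J)
    (hJ' : bounded_closed_invariant r F' J')
    (hsimple : simple_tree (hedge r F J))
    (hsimple' : simple_tree (hedge r F' J'))
    (htau : class_enumeration (hedge r F J) tau)
    (htau' : class_enumeration (hedge r F' J') tau')
    (hA : incidence_matrix (hedge r F J) tau A)
    (hA' : incidence_matrix (hedge r F' J') tau' A')
    (hb : cardinality_vector (hedge r F J) tau b)
    (hb' : cardinality_vector (hedge r F' J') tau' b') :
  (rearrangeable m b A -> rearrangeable m b' A' ->
   lipschitz_equivalent_dust_like m r K K') /\
  (primitive_mx A -> primitive_mx A' ->
   lipschitz_equivalent_dust_like m r K K').
Proof.
have r01 : 0 < r < 1 by case: hr => -> ->.
have [e [G [D [ssD dustD csD]]]] := exists_dust_like r01 (self_similar_alphabet_gt0 hK).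
have equiv : rearrangeable m b A \/ primitive_mx A ->
    rearrangeable m b' A' \/ primitive_mx A' ->
    lipschitz_equivalent_dust_like m r K K'.
  move=> AP AP'.
  have KD : lipschitz_equivalent K D.
    exact: (lipschitz_equivalent_ultrametric r01 hK hH hJ htau hA hb AP csD).
  have KD' : lipschitz_equivalent K' D.
    exact: (lipschitz_equivalent_ultrametric r01 hK' hH' hJ' htau' hA' hb' AP' csD).
  by split; [exact: lipschitz_equivalent_via KD KD'|exists e, G, D].
by split=> AP AP'; apply: equiv; [left|left|right|right].
Qed.
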